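(* Let $f=\frac1n\sum_{i=1}^n f_i$ with minimizer $x^\star$, $f^\star=f(x^\star)$, be $\mu$-strongly quasi-convex around $x^\star$ ($\mu>0$) and $L$-smooth, and let each $f_i$ be $L_i$-smooth; set $\widetilde L=\sqrt{\frac1n\sum_iL_i^2}$. Then there exists a stepsize $\gamma\le\frac{\delta_1\delta_2}{64\sqrt2\,\widetilde L}$ such that after at most $$T=\widetilde{\mathcal O}\left(\frac{\sigma^2}{\mu n\epsilon}+\frac{\sqrt L\sigma}{\mu\delta_1\delta_2\epsilon^{1/2}}+\frac{\widetilde L}{\mu\delta_1\delta_2}\right)$$ iterations of Algorithm D-EC-SGD with bias correction and double contractive compression (described in the context) it holds $\mathbb{E}[f(x_{\mathrm{out}})-f^\star]\le\epsilon$, where $x_{\mathrm{out}}$ is chosen randomly from $\{x_0,\dots,x_T\}$, with $x_t$ chosen with probability proportional to $(1-\gamma\mu/2)^{-(t+1)}$.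
   Context: $f$ is $\mu$-strongly quasi-convex around $x^\star$ if $f(x^\star)\ge f(y)+\langle\nabla f(y),x^\star-y\rangle+\frac\mu2\|x^\star-y\|^2$ for all $y$. For $j=1,2$, $\mathcal{C}_{\delta_j}$ ($0<\delta_j\le1$) is a possibly randomized map with $\mathbb{E}\|\mathcal{C}_{\delta_j}(x)-x\|^2\le(1-\delta_j)\|x\|^2$ for all $x$, independent randomness at each call. Stochastic gradient oracles satisfy $\mathbb{E}[g^i(x)]=\nabla f_i(x)$, $\mathbb{E}\|g^i(x)-\nabla f_i(x)\|^2\le\sigma^2$, fresh independent randomness per call. Algorithm: input $x_0$, $\gamma>0$, $e_0^i=0$, $h_0^i=g^i(x_0)$, $h_0=\frac1n\sum_ih_0^i$. For $t=0,1,\dots$: each client computes $g_t^i=g^i(x_t)$, $\Delta_t^i=\mathcal{C}_{\delta_1}(e_t^i+g_t^i-h_t^i)$, $\hat\Delta_t^i=\mathcal{C}_{\delta_2}(g_t^i-h_t^i)$, $e_{t+1}^i=e_t^i+g_t^i-h_t^i-\Delta_t^i$, $h_{t+1}^i=h_t^i+\hat\Delta_t^i$, and sends $\Delta_t^i,\hat\Delta_t^i$; the server sets $x_{t+1}=x_t-\gamma h_t-\frac\gamma n\sum_i\Delta_t^i$ and $h_{t+1}=h_t+\frac1n\sum_i\hat\Delta_t^i$ (so $h_t=\frac1n\sum_ih_t^i$). $T=\widetilde{\mathcal O}(A)$ means $T$ is at most an absolute constant times $A$ times factors polylogarithmic in the problem parameters and $1/\epsilon$. *)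

(* Defs.v *)
From mathcomp Require Import all_boot all_order all_algebra.
From mathcomp Require Import all_classical all_reals all_analysis.
Set Implicit Arguments. Unset Strict Implicit. Unset Printing Implicit Defensive.
Import Order.TTheory GRing.Theory Num.Theory.
Local Open Scope classical_set_scope.
Local Open Scope ring_scope.

Section Defs.
Context {R : realType}.

Definition dotv {d : nat} (u v : 'rV[R]_d) : R := \sum_(k < d) u ord0 k * v ord0 k.
Definition sqnorm {d : nat} (u : 'rV[R]_d) : R := dotv u u.
Definition norm2 {d : nat} (u : 'rV[R]_d) : R := Num.sqrt (sqnorm u).

Definition is_gradient {d : nat} (f : 'rV[R]_d -> R) (gf : 'rV[R]_d -> 'rV[R]_d) : Prop :=
  forall x, differentiable f x /\ forall v, 'd f x v = dotv (gf x) v.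

Definition lipschitz_grad {d : nat} (gf : 'rV[R]_d -> 'rV[R]_d) (L : R) : Prop :=
  forall x y, norm2 (gf x - gf y) <= L * norm2 (x - y).

Definition strongly_quasi_convex {d : nat} (f : 'rV[R]_d -> R)
  (gf : 'rV[R]_d -> 'rV[R]_d) (mu : R) (xs : 'rV[R]_d) : Prop :=
  forall y, f y + dotv (gf y) (xs - y) + mu / 2 * sqnorm (xs - y) <= f xs.

Definition avgf {n d : nat} (fi : 'I_n -> 'rV[R]_d -> R) : 'rV[R]_d -> R :=
  fun x => n%:R^-1 * \sum_(i < n) fi i x.
Definition avgv {n d : nat} (v : 'I_n -> 'rV[R]_d) : 'rV[R]_d :=
  n%:R^-1 *: \sum_(i < n) v i.

(** Algorithm state: server iterate x_t, client errors e_t^i, client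
    shifts h_t^i, server shift h_t. *)
Record alg_state (n d : nat) := AlgState {
  st_x : 'rV[R]_d;
  st_e : 'I_n -> 'rV[R]_d;
  st_hi : 'I_n -> 'rV[R]_d;
  st_h : 'rV[R]_d }.

(** One iteration, given the stochastic gradients g_t^i (already computed
    at x_t) and the realizations of the two compressors for each client. *)
Definition alg_step {n d : nat} (gamma : R) (g : 'I_n -> 'rV[R]_d)
  (c1 c2 : 'I_n -> 'rV[R]_d -> 'rV[R]_d) (s : alg_state n d) : alg_state n d :=
  let Delta i := c1 i (st_e s i + g i - st_hi s i) in
  let Deltah i := c2 i (g i - st_hi s i) in
  AlgState (st_x s - gamma *: st_h s - (gamma / n%:R) *: \sum_(i < n) Delta i)
           (fun i => st_e s i + g i - st_hi s i - Delta i)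
           (fun i => st_hi s i + Deltah i)
           (st_h s + n%:R^-1 *: \sum_(i < n) Deltah i).

(** Trajectory on the sample space Omega.  Randomness: oracle seeds
    zeta 0 i (initial call h_0^i = g^i(x_0)) and zeta t.+1 i (call
    g_t^i = g^i(x_t) at iteration t); compressor seeds xi1 t i, xi2 t i. *)
Fixpoint alg_traj {n d : nat} {Omega Z X1 X2 : Type} (gamma : R) (x0 : 'rV[R]_d)
  (g : 'I_n -> Z -> 'rV[R]_d -> 'rV[R]_d)
  (C1 : X1 -> 'rV[R]_d -> 'rV[R]_d) (C2 : X2 -> 'rV[R]_d -> 'rV[R]_d)
  (zeta : nat -> 'I_n -> Omega -> Z) (xi1 : nat -> 'I_n -> Omega -> X1)
  (xi2 : nat -> 'I_n -> Omega -> X2) (t : nat) (w : Omega) : alg_state n d :=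
  match t with
  | 0 => let h0 := fun i => g i (zeta 0 i w) x0 in
         AlgState x0 (fun _ => 0) h0 (avgv h0)
  | t'.+1 =>
      let s := alg_traj gamma x0 g C1 C2 zeta xi1 xi2 t' w in
      alg_step gamma (fun i => g i (zeta t i w) (st_x s))
               (fun i => C1 (xi1 t' i w)) (fun i => C2 (xi2 t' i w)) s
  end.

Definition rvec_measurable {dT} {T : measurableType dT} {d : nat}
  (X : T -> 'rV[R]_d) : Prop :=
  forall k : 'I_d, measurable_fun setT (fun t => X t ord0 k).

(** joint measurability of a seeded random map (seed, x) |-> C seed x,
    expressed through compositions with measurable random inputs *)
Definition seeded_measurable {dX} {X : measurableType dX} {d : nat}
  (C : X -> 'rV[R]_d -> 'rV[R]_d) : Prop :=
  forall (dT : measure_display) (T : measurableType dT) (s : T -> X)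
         (V : T -> 'rV[R]_d),
    measurable_fun setT s -> rvec_measurable V ->
    rvec_measurable (fun t => C (s t) (V t)).

Definition contractive {dX} {X : measurableType dX} {d : nat}
  (PX : probability X R) (C : X -> 'rV[R]_d -> 'rV[R]_d) (delta : R) : Prop :=
  forall x : 'rV[R]_d,
    (\int[PX]_xi (sqnorm (C xi x - x))%:E <= ((1 - delta) * sqnorm x)%:E)%E.

Definition stoch_oracle {dZ} {Z : measurableType dZ} {d : nat}
  (PZ : probability Z R) (g : Z -> 'rV[R]_d -> 'rV[R]_d)
  (gf : 'rV[R]_d -> 'rV[R]_d) (sigma : R) : Prop :=
  forall x : 'rV[R]_d,
    (forall k : 'I_d,
        PZ.-integrable setT (fun z => (g z x ord0 k)%:E) /\
        (\int[PZ]_z (g z x ord0 k)%:E = (gf x ord0 k)%:E)%E) /\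
    (\int[PZ]_z (sqnorm (g z x - gf x))%:E <= (sigma ^+ 2)%:E)%E.

Definition fresh_seeds {dO dZ dX1 dX2} {Omega : measurableType dO}
  {Z : measurableType dZ} {X1 : measurableType dX1} {X2 : measurableType dX2}
  {n : nat} (P : probability Omega R)
  (PZ : 'I_n -> probability Z R) (PX1 : probability X1 R) (PX2 : probability X2 R)
  (zeta : nat -> 'I_n -> Omega -> Z) (xi1 : nat -> 'I_n -> Omega -> X1)
  (xi2 : nat -> 'I_n -> Omega -> X2) : Prop :=
  [/\ (forall t i, measurable_fun setT (zeta t i) /\ measurable_fun setT (xi1 t i)
                   /\ measurable_fun setT (xi2 t i)),
      (forall t i (A : set Z), measurable A -> P (zeta t i @^-1` A) = PZ i A),
      (forall t i (A : set X1), measurable A -> P (xi1 t i @^-1` A) = PX1 A),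
      (forall t i (A : set X2), measurable A -> P (xi2 t i @^-1` A) = PX2 A) &
      (forall (J0 J1 J2 : seq (nat * 'I_n)) (A0 : nat * 'I_n -> set Z)
              (A1 : nat * 'I_n -> set X1) (A2 : nat * 'I_n -> set X2),
          uniq J0 -> uniq J1 -> uniq J2 ->
          (forall j, measurable (A0 j)) -> (forall j, measurable (A1 j)) ->
          (forall j, measurable (A2 j)) ->
          P [set w | (forall j, j \in J0 -> A0 j (zeta j.1 j.2 w)) /\
                     (forall j, j \in J1 -> A1 j (xi1 j.1 j.2 w)) /\
                     (forall j, j \in J2 -> A2 j (xi2 j.1 j.2 w))]
          = (\big[*%E/1%E]_(j <- J0) P (zeta j.1 j.2 @^-1` A0 j) *
             \big[*%E/1%E]_(j <- J1) P (xi1 j.1 j.2 @^-1` A1 j) *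
             \big[*%E/1%E]_(j <- J2) P (xi2 j.1 j.2 @^-1` A2 j))%E)].

Definition out_weight (gamma mu : R) (T t : nat) : R :=
  (1 - gamma * mu / 2) ^- t.+1 / \sum_(s < T.+1) (1 - gamma * mu / 2) ^- s.+1.

End Defs.

(* Main.v *)
(** Write e-bar_t for the average of the client errors. The virtual iterate
    z_t = x_t - gamma e-bar_t satisfies z_(t+1) = z_t - gamma g-bar_t, so
    compression enters its recursion only through |e-bar_t|^2. Besides
    X_t = E|z_t - x*|^2, the argument tracks the mean client error E_t and the mean
    distance G_t = E|g_t^i - h_t^i|^2 between stochastic gradients and shifts:
    - X loses gamma E[f(x_t) - f*] and gains 10 l gamma^3 E_t;
    - E contracts at rate 1 - delta1/2 and gains (2/delta1) G_t;
    - G contracts at rate 1 - delta2/2 and gains noise of order sigma^2/delta2 and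
      drift of order L~^2 E|x_(t+1) - x_t|^2/delta2.
    For gamma <= delta1 delta2/(512 L~) a suitable combination X + a E + b G is a
    Lyapunov function, and summing its recursion with weights (1 - gamma mu/2)^-(t+1)
    bounds the output gap. With 1/gamma = 512 mu A, A being the claimed complexity,
    every noise term is at most a fraction of eps, and O(A log) steps kill the initial
    term. Here l = min(L, L~), since nothing forces the given constant L below L~.

    Each conditional expectation is taken by freezing all seeds but one: the remaining
    seed is independent of the sigma-algebra generated by the others, so Tonelli reduces
    an expectation to the one-seed hypothesis on the compressor or on the oracle. *)
From HB Require Import structures.
Require Import Defs.
From mathcomp Require Import all_boot all_order all_algebra.
From mathcomp Require Import all_classical all_reals all_analysis.
From mathcomp Require Import measurable_realfun ring lra.
Import Order.TTheory GRing.Theory Num.Theory.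
Import numFieldNormedType.Exports.
Local Open Scope classical_set_scope.
Local Open Scope ring_scope.

(** * Euclidean geometry and smooth functions *)

Section Euclid.
Context {R : realType} {d : nat}.
Implicit Types u v w : 'rV[R]_d.

Lemma dotvC u v : dotv u v = dotv v u.
Proof. by apply: eq_bigr => k _; rewrite mulrC. Qed.

Lemma dotvDl u v w : dotv (u + v) w = dotv u w + dotv v w.
Proof. by rewrite -big_split; apply: eq_bigr => k _; rewrite mxE mulrDl. Qed.

Lemma dotvZl (a : R) u v : dotv (a *: u) v = a * dotv u v.
Proof. by rewrite mulr_sumr; apply: eq_bigr => k _; rewrite mxE mulrA. Qed.

Lemma dotvNl u v : dotv (- u) v = - dotv u v.
Proof. by rewrite -scaleN1r dotvZl mulN1r. Qed.

Lemma dotvDr u v w : dotv u (v + w) = dotv u v + dotv u w.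
Proof. by rewrite dotvC dotvDl !(dotvC _ u). Qed.

Lemma dotvZr (a : R) u v : dotv u (a *: v) = a * dotv u v.
Proof. by rewrite dotvC dotvZl dotvC. Qed.

Lemma dotvNr u v : dotv u (- v) = - dotv u v.
Proof. by rewrite dotvC dotvNl dotvC. Qed.

Definition dotvE := (dotvDl, dotvDr, dotvNl, dotvNr, dotvZl, dotvZr).

Lemma sqnorm_ge0 u : 0 <= sqnorm u.
Proof. by apply: sumr_ge0 => k _; rewrite -expr2 sqr_ge0. Qed.

Lemma sqnormN u : sqnorm (- u) = sqnorm u.
Proof. by rewrite /sqnorm !dotvE opprK. Qed.

Lemma sqnormZ (a : R) u : sqnorm (a *: u) = a ^+ 2 * sqnorm u.
Proof. by rewrite /sqnorm !dotvE mulrA. Qed.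

Lemma sqnormD u v : sqnorm (u + v) = sqnorm u + 2 * dotv u v + sqnorm v.
Proof. by rewrite /sqnorm !dotvE (dotvC v u); ring. Qed.

Lemma sqnorm0 : sqnorm (0 : 'rV[R]_d) = 0.
Proof. by rewrite /sqnorm -(scale0r 0) dotvZl mul0r. Qed.

(** This is [|c u - v|^2 >= 0], expanded and divided by [c]. *)
Lemma dotv_young (c : R) u v : 0 < c ->
  2 * dotv u v <= c * sqnorm u + c^-1 * sqnorm v.
Proof.
move=> c0; have := sqnorm_ge0 (c *: u - v).
rewrite sqnormD sqnormZ sqnormN !dotvE => h.
rewrite -(ler_pM2l c0) mulrDr (mulrA c c^-1) divff ?gt_eqF// mul1r; lra.
Qed.

Lemma sqnormD_young (c : R) u v : 0 < c ->
  sqnorm (u + v) <= (1 + c) * sqnorm u + (1 + c^-1) * sqnorm v.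
Proof. by move=> c0; rewrite sqnormD; have := dotv_young _ u v c0; lra. Qed.

Lemma sqnormD2 u v : sqnorm (u + v) <= 2 * sqnorm u + 2 * sqnorm v.
Proof.
by apply: le_trans (sqnormD_young 1 _ _ ltr01) _; rewrite invr1; lra.
Qed.

Lemma sqnormD3 u v w :
  sqnorm (u + v + w) <= 3 * sqnorm u + 3 * sqnorm v + 3 * sqnorm w.
Proof.
rewrite !sqnormD !dotvE.
have := dotv_young _ u v ltr01; have := dotv_young _ u w ltr01.
have := dotv_young _ v w ltr01; rewrite invr1; lra.
Qed.

Lemma sqr_coord_le u k : u ord0 k ^+ 2 <= sqnorm u.
Proof.
by rewrite /sqnorm /dotv (bigD1 k)//= expr2 lerDl sumr_ge0// => i _;
  rewrite -expr2 sqr_ge0.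
Qed.

Lemma norm2_leE u v (c : R) : norm2 u <= c * norm2 v ->
  sqnorm u <= c ^+ 2 * sqnorm v.
Proof.
move=> h; have h0 : 0 <= norm2 u by exact: sqrtr_ge0.
have := ler_pM h0 h0 h h; rewrite -!expr2 exprMn /norm2.
by rewrite !sqr_sqrtr ?sqnorm_ge0.
Qed.

Lemma dotv_sumr (I : Type) (s : seq I) u (v : I -> 'rV[R]_d) :
  dotv u (\sum_(i <- s) v i) = \sum_(i <- s) dotv u (v i).
Proof.
elim: s => [|i s IH]; last by rewrite !big_cons dotvDr IH.
by rewrite !big_nil -(scale0r u) dotvZr mul0r.
Qed.

(** The gap between the two sides is the mean squared deviation of the [v i] from their average. For
    [n = 0] both sides vanish because the inverse of 0 is 0. *)
Lemma sqnorm_avgv (n : nat) (v : 'I_n -> 'rV[R]_d) :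
  sqnorm (avgv v) <= n%:R^-1 * \sum_(i < n) sqnorm (v i).
Proof.
case: n v => [|n] v; first by rewrite /avgv invr0 scale0r sqnorm0 mul0r.
have n0 : 0 < n.+1%:R :> R by rewrite ltr0n.
suff h : 0 <= n.+1%:R^-1 * \sum_(i < n.+1) sqnorm (v i) - sqnorm (avgv v).
  by rewrite -subr_ge0.
have -> : n.+1%:R^-1 * \sum_(i < n.+1) sqnorm (v i) - sqnorm (avgv v)
        = n.+1%:R^-1 * \sum_(i < n.+1) sqnorm (v i - avgv v).
  have E i : sqnorm (v i - avgv v)
      = sqnorm (v i) + (sqnorm (avgv v) - 2 * dotv (avgv v) (v i)).
    by rewrite sqnormD sqnormN dotvNr dotvC; ring.
  under [in RHS]eq_bigr do rewrite E.
  rewrite big_split big_split /= sumr_const card_ord sumrN -mulr_sumr -dotv_sumr.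
  have -> : \sum_(i < n.+1) v i = n.+1%:R *: avgv v.
    by rewrite scalerA divff ?gt_eqF// scale1r.
  rewrite dotvZr -/(sqnorm _) -mulr_natl.
  by field; rewrite addrC natr1 gt_eqF.
by rewrite mulr_ge0 ?invr_ge0 ?ler0n// sumr_ge0// => i _; exact: sqnorm_ge0.
Qed.

End Euclid.

(** * Functions with Lipschitz gradient *)

Section Smooth.
Context {R : realType} {d : nat}.
Variables (f : 'rV[R]_d -> R) (gf : 'rV[R]_d -> 'rV[R]_d).
Hypothesis fgf : is_gradient f gf.

(** Restricting [f] to the segment from [x] to [x + v] reduces this to the one-variable mean value
    theorem. *)
Lemma gradient_mvt (x v : 'rV[R]_d) :
  exists2 c : R, 0 < c < 1 & f (x + v) - f x = dotv (gf (x + c *: v)) v.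
Proof.
have der (s : R) : is_derive s 1 (fun s : R => f (x + s *: v)) (dotv (gf (x + s *: v)) v).
  have [df dE] := fgf (x + s *: v).
  rewrite -dE -deriveE//.
  have /derivableP := diff_derivable (v := v) df.
  move=> [h1 h2]; have := h1; rewrite /derivable => h1'.
  (* The difference quotient of [f] along [v] is the ordinary quotient of the restriction at [s], so
     the derivative carries over. *)
  have e : (fun h : R => h^-1 *: ((f \o shift (x + s *: v)) (h *: v) - f (x + s *: v)))
    = (fun h : R => h^-1 *: (((fun s : R => f (x + s *: v)) \o shift s) (h *: (1:R))
         - f (x + s *: v))).
    apply/funext => h /=; rewrite /shift /=.
    by rewrite [h *: 1]mulr1 scalerDl addrCA.
  split; first by rewrite /derivable -e.
  by rewrite /derive -e.
have [|c c01 /= cE] := @MVT R _ _ 0 1 ltr01 (fun s _ => der s).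
  by apply: derivable_within_continuous => s _; have [] := der s.
exists c; first by rewrite in_itv/= in c01.
by move: cE; rewrite scale1r scale0r addr0 subr0 mulr1.
Qed.

Lemma gradient_continuous : continuous f.
Proof. by move=> x; apply: differentiable_continuous; have [] := fgf x. Qed.

Variables (L : R) (fmin : R).
Hypothesis Lgf : forall x y, sqnorm (gf x - gf y) <= L ^+ 2 * sqnorm (x - y).
Hypothesis fmin_le : forall x, fmin <= f x.

(* One gradient step of length 1/(2L) decreases f by at least |grad f|^2/(4L). *)
Lemma sqnorm_gradient_le (x : 'rV[R]_d) : 0 < L ->
  sqnorm (gf x) <= 4 * L * (f x - fmin).
Proof.
move=> L0; pose s := (2 * L)^-1.
have s0 : 0 < s by rewrite invr_gt0 mulr_gt0.
have sL : s * L = 2^-1 by rewrite /s; field; rewrite gt_eqF.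
have [c /andP[c0 c1] cE] := gradient_mvt x (- s *: gf x).
have h1 := fmin_le (x + - s *: gf x).
set y := x + c *: _ in cE.
have h2 := dotv_young 2 (gf x - gf y) (gf x) ltac:(lra).
(* The point [y] lies within [|gf x| / (2L)] of [x], so the gradient changes by at most half its
   norm on the way. *)
have h3 : sqnorm (gf x - gf y) <= 4^-1 * sqnorm (gf x).
  apply: le_trans (Lgf _ _) _.
  rewrite /y opprD addNKr scalerA -scaleNr sqnormZ mulrA ler_wpM2r ?sqnorm_ge0//.
  have -> : L ^+ 2 * (- (c * - s)) ^+ 2 = c ^+ 2 * 4^-1.
    by transitivity (c ^+ 2 * (s * L) ^+ 2); [ring | rewrite sL; congr (_ * _); field].
  by rewrite ler_piMl ?invr_ge0 ?ler0n// exprn_ile1 // ltW.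
move: h2 cE; rewrite !dotvE -/(sqnorm (gf x)) => h2 cE.
have h4 : 2^-1 * sqnorm (gf x) <= dotv (gf y) (gf x) * 1.
  by have := sqnorm_ge0 (gf x); lra.
have h5 : s * (2^-1 * sqnorm (gf x)) <= s * (dotv (gf y) (gf x) * 1).
  by rewrite ler_pM2l.
have h6 : s * (2^-1 * sqnorm (gf x)) <= f x - fmin by lra.
have : 4 * L * (s * (2^-1 * sqnorm (gf x))) <= 4 * L * (f x - fmin).
  by rewrite ler_pM2l ?mulr_gt0.
have -> : 4 * L * (s * (2^-1 * sqnorm (gf x))) = 2 * (s * L) * sqnorm (gf x) by field.
rewrite sL; lra.
Qed.

End Smooth.

(* [z = x - gamma e] is the virtual iterate of error feedback: its perturbed
   gradient step contracts up to an error of order gamma^3 |e|^2. *)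
Lemma virtual_gradient_step {R : realType} {d : nat} (f : 'rV[R]_d -> R)
    (gf : 'rV[R]_d -> 'rV[R]_d) (xs x e : 'rV[R]_d) (mu l gamma : R) :
  strongly_quasi_convex f gf mu xs -> sqnorm (gf x) <= 4 * l * (f x - f xs) ->
  f xs <= f x -> 0 < mu -> 0 < l -> mu <= 2 * l -> 0 < gamma -> 16 * (gamma * l) <= 1 ->
  sqnorm (x - gamma *: e - xs - gamma *: gf x) + gamma * (f x - f xs)
    <= (1 - gamma * mu / 2) * sqnorm (x - gamma *: e - xs)
       + 10 * l * gamma ^+ 3 * sqnorm e.
Proof.
move=> sqc GG F0 mu0 l0 mu_le_2l gamma0 gl16.
have := sqc x.
have -> : xs - x = - (x - xs) by rewrite opprB.
rewrite sqnormN dotvNr (dotvC (gf x)).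
have -> : x - gamma *: e - xs = (x - xs) - gamma *: e by rewrite addrAC.
move: (x - xs) => y; set G := gf x in GG *; set F := f x - f xs in GG *.
have c0 : 0 < 8 * l * gamma by rewrite !mulr_gt0.
(* With this weight the gradient half of the cross term becomes, through the bound on [|G|^2],
   exactly [gamma / 2 * F], while the error half costs [8 l gamma^3 |e|^2]. *)
have yg := dotv_young (8 * l * gamma) e G c0.
rewrite invfM -/(_ / _) in yg.
(* By the parallelogram law this gives [|y - gamma e|^2 <= 2 |y|^2 + 2 gamma^2 |e|^2], which moves
   the contraction from [x] to the virtual iterate and halves its rate. *)
have yp := sqnorm_ge0 (y + gamma *: e).
rewrite sqnormD sqnormZ !dotvE in yp.
have X0 := sqnorm_ge0 (y - gamma *: e).
rewrite (sqnormD (y - gamma *: e)) sqnormN sqnormZ.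
rewrite sqnormD sqnormN sqnormZ !dotvE in X0 *.
move: yg GG yp X0 {c0}.
move: (sqnorm e) (sqnorm_ge0 e) (sqnorm y) (sqnorm G) (dotv y e) (dotv y G) (dotv e G).
move=> ee ee0 yy GG ye yG eG yg hG yp X0 hsqc.
have g2 : 0 < gamma ^+ 2 by rewrite exprn_gt0.
have h1 : gamma * (yG - F - mu / 2 * yy) >= 0.
  by rewrite mulr_ge0 ?(ltW gamma0)//; rewrite /F; lra.
have h2 : gamma ^+ 2 * (2 * eG) <= 8 * l * gamma ^+ 3 * ee + gamma / 2 * F.
  apply: (@le_trans _ _ (gamma ^+ 2 * (8 * l * gamma * ee + (8 * l)^-1 / gamma * (4 * l * F)))).
    rewrite ler_pM2l//; apply: le_trans yg _; rewrite lerD2l ler_wpM2l//.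
    by rewrite divr_ge0 ?invr_ge0 ?mulr_ge0 ?ltW.
  rewrite le_eqVlt; apply/orP; left; apply/eqP; field.
  by rewrite !gt_eqF.
have F0' : 0 <= F by rewrite subr_ge0.
have h3 : gamma ^+ 2 * GG <= gamma / 4 * F.
  apply: (@le_trans _ _ (gamma ^+ 2 * (4 * l * F))); first by rewrite ler_pM2l.
  have -> : gamma ^+ 2 * (4 * l * F) = 16 * (gamma * l) * (gamma / 4 * F) by field.
  by rewrite ler_piMl// mulr_ge0// divr_ge0// ltW.
have h4 : gamma * mu / 2 * (yy + 2 * (gamma * ye) + gamma ^+ 2 * ee) >= 0.
  by rewrite mulr_ge0// divr_ge0// mulr_ge0// ltW.
(* The cost of that move; together with the 8 from Young's inequality it makes the constant 10. *)
have h5 : gamma ^+ 3 * ee * mu <= gamma ^+ 3 * ee * (2 * l).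
  by rewrite ler_wpM2l// mulr_ge0// exprn_ge0// ltW.
have h6 : 0 <= gamma * F by rewrite mulr_ge0// ltW.
lra.
Qed.

(** * Measurability of random vectors *)

Section RvecMeasurable.
Context {R : realType} {dT : measure_display} {T : measurableType dT} {d : nat}.
Implicit Types U V : T -> 'rV[R]_d.

Lemma rvec_measurableD U V : rvec_measurable U -> rvec_measurable V ->
  rvec_measurable (fun w => U w + V w).
Proof.
move=> mU mV k; under eq_fun do rewrite mxE.
exact: measurable_funD (mU k) (mV k).
Qed.

Lemma rvec_measurableZ (a : R) V : rvec_measurable V ->
  rvec_measurable (fun w => a *: V w).
Proof.
move=> mV k; under eq_fun do rewrite mxE.
exact: measurable_funM (measurable_cst _) (mV k).
Qed.

Lemma rvec_measurableN V : rvec_measurable V -> rvec_measurable (fun w => - V w).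
Proof.
by move=> mV; under eq_fun do rewrite -scaleN1r; exact: rvec_measurableZ.
Qed.

Lemma rvec_measurableB U V : rvec_measurable U -> rvec_measurable V ->
  rvec_measurable (fun w => U w - V w).
Proof. by move=> mU mV; apply: rvec_measurableD => //; exact: rvec_measurableN. Qed.

Lemma rvec_measurable_cst (v : 'rV[R]_d) : rvec_measurable (fun _ : T => v).
Proof. by move=> k; exact: measurable_cst. Qed.

Lemma rvec_measurable_sum (I : Type) (s : seq I) (V : I -> T -> 'rV[R]_d) :
  (forall i, rvec_measurable (V i)) ->
  rvec_measurable (fun w => \sum_(i <- s) V i w).
Proof.
move=> mV; elim: s => [|i s IH].
  by under eq_fun do rewrite big_nil; exact: rvec_measurable_cst.
by under eq_fun do rewrite big_cons; exact: rvec_measurableD.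
Qed.

Lemma rvec_measurable_avgv (n : nat) (V : 'I_n -> T -> 'rV[R]_d) :
  (forall i, rvec_measurable (V i)) ->
  rvec_measurable (fun w => avgv (fun i => V i w)).
Proof. by move=> mV; apply/rvec_measurableZ/rvec_measurable_sum. Qed.

Lemma measurable_sqnorm V : rvec_measurable V ->
  measurable_fun setT (fun w => sqnorm (V w)).
Proof.
by move=> mV; apply: measurable_sum => k; apply: measurable_funM; exact: mV.
Qed.

(** Measurability of [V] is only known coordinatewise. A sup-norm ball is a finite intersection of
    coordinate conditions, and an open set is a countable union of balls with rational centres and
    radii [1/(m+1)], so preimages of open sets are measurable. *)
Lemma measurable_continuous_comp (f : 'rV[R]_d -> R) V :
  continuous f -> rvec_measurable V -> measurable_fun setT (fun w => f (V w)).
Proof.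
move=> cf mV.
have mball (c : 'rV[R]_d) (r : R) : 0 < r -> measurable [set w | ball c r (V w)].
  move=> r0.
  have -> : [set w | ball c r (V w)]
      = \bigcap_(k in [set: 'I_d]) (setT `&` (fun w => V w ord0 k) @^-1` ball (c ord0 k) r).
    apply/seteqP; split => [w /= [_ h] k _|w /= h].
      by split => //; exact: h.
    by split => // i k; rewrite [i]ord1; have [] := h k Logic.I.
  apply: fin_bigcap_measurable; first exact: finite_finset.
  move=> k _; apply: mV; first exact: measurableT.
  exact: measurable_ball.
have mopen (U : set 'rV[R]_d) : open U -> measurable [set w | U (V w)].
  move=> oU.
  pose q (p : 'rV[rat]_d) : 'rV[R]_d := map_mx ratr p.
  have -> : [set w | U (V w)] = \bigcup_(pr in [set pr : 'rV[rat]_d * nat |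
      ball (q pr.1) pr.2.+1%:R^-1 `<=` U])
        [set w | ball (q pr.1) pr.2.+1%:R^-1 (V w)].
    apply/seteqP; split => [w /= Uw|w [pr /= prU]]; last exact: prU.
    have /nbhs_ballP[e /= e0 eU] : nbhs (V w) U by exact: open_nbhs_nbhs.
    (* Half of [e]: a ball of this radius around a rational centre that contains [V w] then stays
       inside the ball of radius [e] around [V w]. *)
    have [m me] : exists m : nat, m.+1%:R^-1 < e / 2.
      have [m _ /(_ _ (leqnn m))] := near_infty_natSinv_lt (PosNum (divr_gt0 e0 (ltr0Sn R 1))).
      by exists m.
    have m0 : 0 < m.+1%:R^-1 :> R by rewrite invr_gt0 ltr0n.
    set r : R := m.+1%:R^-1 in m0 me *.
    have [p Hp] : exists p : 'rV[rat]_d, ball (q p) r (V w).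
      have h k : exists x : rat, `|ratr x - V w ord0 k| < r.
        have [|x] := @rat_in_itvoo R (V w ord0 k - r) (V w ord0 k + r).
          by rewrite ltrD2l gtrN.
        by rewrite in_itv/= => /andP[x1 x2]; exists x; rewrite ltr_norml; lra.
      have [p Hp] := choice h.
      exists (\row_k p k); split => // i k; rewrite [i]ord1 !mxE.
      exact: Hp.
    exists (p, m) => //= y py; apply: eU.
    apply: (@le_ball _ _ _ (r + r)); first by rewrite ltW// [ltRHS]splitr ltrD.
    by apply: ball_triangle py; exact: ball_sym.
  rewrite bigcup_mkcond; apply: countable_bigcupT_measurable => // pr.
  by case: ifP => // _; apply: mball; rewrite invr_gt0 ltr0n.
apply: (measurability _ (RGenOInfty.measurableE R)).
move=> _ [_ [a ->] <-]; rewrite setTI.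
apply: (mopen (f @^-1` `]a, +oo[)).
apply: open_comp => [x _|]; [exact: cf|exact: interval_open].
Qed.

End RvecMeasurable.

(** * Freezing all seeds but one *)

Section Freeze.
Context {R : realType} {dO dX : measure_display}
  {Omega : measurableType dO} {X : measurableType dX}.
Variables (P : probability Omega R) (PX : probability X R) (xi : Omega -> X).
Variable G : set (set Omega).
Hypothesis mxi : measurable_fun setT xi.
Hypothesis Gm : G `<=` measurable.
Hypothesis GI : setI_closed G.
Hypothesis GT : G setT.
Hypothesis indepG : forall A B, G A -> measurable B ->
  P (A `&` xi @^-1` B) = (P A * PX B)%E.
Local Notation OG := (g_sigma_algebraType G).

Lemma g_sigma_measurable (A : set Omega) : <<s G >> A -> measurable A.
Proof. by apply: smallest_sub => //; exact: sigma_algebra_measurable. Qed.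

(** For fixed [B] both sides are finite measures in [A] that agree on the pi-system [G], hence on
    the sigma-algebra it generates. *)
Lemma indep_g_sigma (A : set Omega) B : <<s G >> A -> measurable B ->
  P (A `&` xi @^-1` B) = (P A * PX B)%E.
Proof.
move=> GA mB.
have mxB : measurable (xi @^-1` B) by rewrite -[_ @^-1` _]setTI; exact: mxi.
have r0 : 0 <= fine (PX B) by exact: fine_ge0.
pose m1 := mrestr P mxB.
pose m2 := mscale (NngNum r0) P.
have m2E C : m2 C = (P C * PX B)%E.
  transitivity ((fine (PX B))%:E * P C)%E; first by [].
  by rewrite fineK ?fin_num_measure// muleC.
suff -> : P (A `&` xi @^-1` B) = m2 A by exact: m2E.
apply: (@g_sigma_algebra_measure_unique _ R _ G Gm (fun=> setT) _ _ m1 m2) => //.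
- by apply/seteqP; split => // x _; exists 0%N.
- by move=> C GC; rewrite [LHS]indepG//; exact/esym/m2E.
- move=> _; rewrite /m1 /mrestr /=; apply: le_lt_trans (ltry 1).
  by apply: probability_le1; exact: measurableI.
Qed.

(** Seen as a map into the coarser space [OG], the identity pushes [P] forward to its restriction to
    the generated sigma-algebra. *)
Let mid : measurable_fun setT (fun w : Omega => w : OG).
Proof. by move=> _ A GA; rewrite setTI; exact: g_sigma_measurable. Qed.

Let joint (w : Omega) : (X * OG)%type := (xi w, w).

Let mjoint : measurable_fun setT joint.
Proof. exact: measurable_fun_pair. Qed.

Let idm_mixin := isMeasurableFun.Build _ _ _ _ _ mid.
Let idm : {mfun Omega >-> OG} := HB.pack (fun w : Omega => w : OG) idm_mixin.

(* The joint law of [xi] and the identity on [OG] is a product measure. *)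
Lemma integral_freeze_le (phi : X * OG -> R) (K : OG -> R) :
  measurable_fun setT phi -> (forall z, 0 <= phi z) ->
  measurable_fun setT K ->
  (forall w, \int[PX]_x (phi (x, w))%:E <= (K w)%:E)%E ->
  (\int[P]_w (phi (xi w, w))%:E <= \int[P]_w (K w)%:E)%E.
Proof.
move=> mphi phi0 mK phiK.
have K0 w : 0 <= K w.
  rewrite -lee_fin; apply: le_trans (phiK w); apply: integral_ge0 => x _.
  by rewrite lee_fin.
have mEphi : measurable_fun setT (EFin \o phi) by exact/measurable_EFinP.
have mEK : measurable_fun setT (EFin \o K) by exact/measurable_EFinP.
pose PG : probability OG R := distribution P idm.
have -> : (\int[P]_w (K w)%:E = \int[PG]_w (K w)%:E)%E.
  by rewrite [RHS]ge0_integral_pushforward// => w _; rewrite lee_fin.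
have -> : (\int[P]_w (phi (xi w, w))%:E = \int[PX \x PG]_z (phi z)%:E)%E.
  transitivity (\int[pushforward P joint]_z (EFin \o phi) z)%E.
    by rewrite [RHS]ge0_integral_pushforward// => z _; rewrite lee_fin.
  apply: eq_measure_integral => A mA _.
  apply/esym; apply: product_measure_unique => // B1 B2 mB1 mB2.
  rewrite /= /pushforward muleC -[in RHS]indep_g_sigma//; congr (P _).
  by apply/seteqP; split => w [].
rewrite fubini_tonelli2//; apply: ge0_le_integral => //.
- by move=> w _; apply: integral_ge0 => x _; rewrite lee_fin.
- exact: measurable_fun_fubini_tonelli_G.
- by move=> w _; exact: phiK.
Qed.

End Freeze.

(** * Events that constrain finitely many seeds *)

Section Cylinders.
Context {R : realType} {dO dZ dX1 dX2 : measure_display}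
  {Omega : measurableType dO} {Z : measurableType dZ}
  {X1 : measurableType dX1} {X2 : measurableType dX2} {n : nat}.
Variables (P : probability Omega R) (PZ : 'I_n -> probability Z R)
  (PX1 : probability X1 R) (PX2 : probability X2 R)
  (zeta : nat -> 'I_n -> Omega -> Z) (xi1 : nat -> 'I_n -> Omega -> X1)
  (xi2 : nat -> 'I_n -> Omega -> X2).
Hypothesis fresh : fresh_seeds P PZ PX1 PX2 zeta xi1 xi2.
Local Notation I := (nat * 'I_n)%type.

Definition in_box {Y : Type} (J : seq I) (A : I -> set Y) (z : I -> Y) : Prop :=
  forall j, j \in J -> A j (z j).

(** Indices missing from one list are unconstrained by it, so that the intersection of two boxes is
    again a box, over the union of the lists. *)
Definition box_inter {Y : Type} (J J' : seq I) (A A' : I -> set Y) (j : I) : set Y :=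
  (if j \in J then A j else setT) `&` (if j \in J' then A' j else setT).

Lemma in_boxI {Y : Type} (J J' : seq I) (A A' : I -> set Y) (z : I -> Y) :
  in_box (undup (J ++ J')) (box_inter J J' A A') z
  <-> in_box J A z /\ in_box J' A' z.
Proof.
split=> [h|[h h'] j _].
  split=> j jJ; have := h j; rewrite mem_undup mem_cat jJ ?orbT.
    by move=> /(_ isT)[]; rewrite jJ.
  by move=> /(_ isT)[]; rewrite jJ.
by split; case: ifP => // jJ; [exact: h|exact: h'].
Qed.

Lemma measurable_box_inter {dY : measure_display} {Y : measurableType dY}
  (J J' : seq I) (A A' : I -> set Y) :
  (forall j, measurable (A j)) -> (forall j, measurable (A' j)) ->
  forall j, measurable (box_inter J J' A A' j).
Proof. by move=> mA mA' j; apply: measurableI; case: ifP. Qed.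

Lemma measurable_in_box {dY : measure_display} {Y : measurableType dY}
  (J : seq I) (A : I -> set Y) (z : nat -> 'I_n -> Omega -> Y) :
  (forall t i, measurable_fun setT (z t i)) -> (forall j, measurable (A j)) ->
  measurable [set w | in_box J A (fun j => z j.1 j.2 w)].
Proof.
move=> mz mA.
have -> : [set w | in_box J A (fun j => z j.1 j.2 w)]
    = \bigcap_(j in [set` J]) (setT `&` z j.1 j.2 @^-1` A j).
  by apply/seteqP; split => w h j jJ; [split => //; exact: h|have [] := h j jJ].
apply: fin_bigcap_measurable => [|j _]; first exact: finite_seq.
exact: mz.
Qed.

Definition cylinder (J0 J1 J2 : seq I) (A0 : I -> set Z) (A1 : I -> set X1)
    (A2 : I -> set X2) : set Omega :=
  [set w | in_box J0 A0 (fun j => zeta j.1 j.2 w) /\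
           in_box J1 A1 (fun j => xi1 j.1 j.2 w) /\
           in_box J2 A2 (fun j => xi2 j.1 j.2 w)].

(** The predicates select the seeds that may be constrained. Excluding a single index with [predC1]
    yields a pi-system generating the information carried by all other seeds. *)
Definition cylinders (p0 p1 p2 : pred I) : set (set Omega) :=
  [set C | exists J0 J1 J2 A0 A1 A2,
     [/\ [/\ uniq J0, uniq J1 & uniq J2], [/\ all p0 J0, all p1 J1 & all p2 J2],
      [/\ forall j, measurable (A0 j), forall j, measurable (A1 j)
        & forall j, measurable (A2 j)]
      & C = cylinder J0 J1 J2 A0 A1 A2]].

Lemma cylinders_measurable p0 p1 p2 : cylinders p0 p1 p2 `<=` measurable.
Proof.
have [m _ _ _ _] := fresh.
move=> _ [J0 [J1 [J2 [A0 [A1 [A2 [_ _ [m0 m1 m2] ->]]]]]]].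
apply: measurableI; first by apply: measurable_in_box => // t i; have [] := m t i.
by apply: measurableI; apply: measurable_in_box => // t i; have [_ []] := m t i.
Qed.

Lemma cylindersI p0 p1 p2 : setI_closed (cylinders p0 p1 p2).
Proof.
move=> _ _ [J0 [J1 [J2 [A0 [A1 [A2 [_ [p_0 p_1 p_2] [m0 m1 m2] ->]]]]]]]
  [J0' [J1' [J2' [A0' [A1' [A2' [_ [p_0' p_1' p_2'] [m0' m1' m2'] ->]]]]]]].
exists (undup (J0 ++ J0')), (undup (J1 ++ J1')), (undup (J2 ++ J2')).
exists (box_inter J0 J0' A0 A0'), (box_inter J1 J1' A1 A1'), (box_inter J2 J2' A2 A2').
split.
- by rewrite !undup_uniq.
- by split; rewrite all_undup all_cat; apply/andP.
- by split; exact: measurable_box_inter.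
- apply/seteqP; split => [w [[h0 [h1 h2]] [h0' [h1' h2']]]
    |w [/in_boxI[h0 h0'] [/in_boxI[h1 h1'] /in_boxI[h2 h2']]]] //.
  by split; [|split]; apply/in_boxI.
Qed.

Lemma cylindersT p0 p1 p2 : cylinders p0 p1 p2 setT.
Proof.
exists [::], [::], [::], (fun=> setT), (fun=> setT), (fun=> setT); split => //.
by apply/seteqP; split => // w _; do !split.
Qed.

Let upd {Y : Type} (A : I -> set Y) (j : I) (B : set Y) (k : I) :=
  if k == j then B else A k.

Let updE {Y : Type} (A : I -> set Y) j B : @upd Y A j B j = B.
Proof. by rewrite /upd eqxx. Qed.

Let in_box_upd {Y : Type} (J : seq I) (A : I -> set Y) j B (z : I -> Y) :
  j \notin J -> in_box (j :: J) (upd A j B) z <-> in_box J A z /\ B (z j).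
Proof.
move=> jJ; split=> [h|[h Bz] k].
  split=> [k kJ|]; last by have := h j (mem_head _ _); rewrite updE.
  have := h k; rewrite inE kJ orbT /upd => /(_ isT).
  by case: eqP => // kj; rewrite -kj kJ in jJ.
by rewrite inE /upd; case: eqP => [->//|_ /=]; exact: h.
Qed.

Let measurable_upd {dY : measure_display} {Y : measurableType dY}
  (A : I -> set Y) j B : measurable B -> (forall k, measurable (A k)) ->
  forall k, measurable (upd A j B k).
Proof. by move=> mB mA k; rewrite /upd; case: ifP. Qed.

Let prod_upd {Y : Type} (J : seq I) (A : I -> set Y) j B (z : nat -> 'I_n -> Omega -> Y) :
  j \notin J ->
  (\big[*%E/1%E]_(k <- j :: J) P (z k.1 k.2 @^-1` upd A j B k) =
  P (z j.1 j.2 @^-1` B) * \big[*%E/1%E]_(k <- J) P (z k.1 k.2 @^-1` A k))%E.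
Proof.
move=> jJ; rewrite big_cons updE; congr (_ * _)%E; apply: eq_big_seq => k kJ.
by rewrite /upd; case: eqP => // kj; rewrite -kj kJ in jJ.
Qed.

Lemma cylinder_prob J0 J1 J2 A0 A1 A2 : uniq J0 -> uniq J1 -> uniq J2 ->
  (forall j, measurable (A0 j)) -> (forall j, measurable (A1 j)) ->
  (forall j, measurable (A2 j)) ->
  P (cylinder J0 J1 J2 A0 A1 A2) =
     (\big[*%E/1%E]_(j <- J0) P (zeta j.1 j.2 @^-1` A0 j) *
      \big[*%E/1%E]_(j <- J1) P (xi1 j.1 j.2 @^-1` A1 j) *
      \big[*%E/1%E]_(j <- J2) P (xi2 j.1 j.2 @^-1` A2 j))%E.
Proof. by have [_ _ _ _] := fresh; exact. Qed.

(** Intersecting with a condition on seed [j] gives a cylinder with one more index, and the product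
    formula for its probability gains exactly one factor. *)
Lemma cylinders_indep_zeta j A B : cylinders (predC1 j) predT predT A ->
  measurable B -> P (A `&` zeta j.1 j.2 @^-1` B) = (P A * PZ j.2 B)%E.
Proof.
move=> [J0 [J1 [J2 [A0 [A1 [A2 [[u0 u1 u2] [p0 _ _] [m0 m1 m2] ->]]]]]]] mB.
have jJ : j \notin J0 by apply/negP => /(allP p0) /=; rewrite eqxx.
have -> : cylinder J0 J1 J2 A0 A1 A2 `&` zeta j.1 j.2 @^-1` B
    = cylinder (j :: J0) J1 J2 (upd A0 j B) A1 A2.
  apply/seteqP; split => [w [[h0 h] Bw]|w [/(in_box_upd _ _ _ _ _ jJ)[h0 Bw] h]].
    by split => //; apply/in_box_upd.
  by split.
have [_ lZ _ _ _] := fresh.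
rewrite !cylinder_prob//=; [|by rewrite jJ|exact: measurable_upd].
by rewrite prod_upd// lZ// -!muleA [LHS]muleC -!muleA.
Qed.

Lemma cylinders_indep_xi1 j A B : cylinders predT (predC1 j) predT A ->
  measurable B -> P (A `&` xi1 j.1 j.2 @^-1` B) = (P A * PX1 B)%E.
Proof.
move=> [J0 [J1 [J2 [A0 [A1 [A2 [[u0 u1 u2] [_ p1 _] [m0 m1 m2] ->]]]]]]] mB.
have jJ : j \notin J1 by apply/negP => /(allP p1) /=; rewrite eqxx.
have -> : cylinder J0 J1 J2 A0 A1 A2 `&` xi1 j.1 j.2 @^-1` B
    = cylinder J0 (j :: J1) J2 A0 (upd A1 j B) A2.
  apply/seteqP; split => [w [[h0 [h1 h2]] Bw]|w [h0 [/(in_box_upd _ _ _ _ _ jJ)[h1 Bw] h2]]].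
    by split => //; split => //; apply/in_box_upd.
  by split.
have [_ _ l1 _ _] := fresh.
rewrite !cylinder_prob//=; [|by rewrite jJ|exact: measurable_upd].
by rewrite prod_upd// l1// muleCA -!muleA muleC -!muleA.
Qed.

Lemma cylinders_indep_xi2 j A B : cylinders predT predT (predC1 j) A ->
  measurable B -> P (A `&` xi2 j.1 j.2 @^-1` B) = (P A * PX2 B)%E.
Proof.
move=> [J0 [J1 [J2 [A0 [A1 [A2 [[u0 u1 u2] [_ _ p2] [m0 m1 m2] ->]]]]]]] mB.
have jJ : j \notin J2 by apply/negP => /(allP p2) /=; rewrite eqxx.
have -> : cylinder J0 J1 J2 A0 A1 A2 `&` xi2 j.1 j.2 @^-1` B
    = cylinder J0 J1 (j :: J2) A0 A1 (upd A2 j B).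
  apply/seteqP; split => [w [[h0 [h1 h2]] Bw]|w [h0 [h1 /(in_box_upd _ _ _ _ _ jJ)[h2 Bw]]]].
    by split => //; split => //; apply/in_box_upd.
  by split.
have [_ _ _ l2 _] := fresh.
rewrite !cylinder_prob//=; [|by rewrite jJ|exact: measurable_upd].
by rewrite prod_upd// l2// muleCA muleC.
Qed.

(** The preimage of a measurable set under an allowed seed is itself a cylinder with one constrained
    index. *)
Lemma measurable_cylinders_zeta (p0 p1 p2 : pred I) j : p0 j ->
  measurable_fun setT (zeta j.1 j.2 : g_sigma_algebraType (cylinders p0 p1 p2) -> Z).
Proof.
move=> pj _ B mB; rewrite setTI; apply: sub_sigma_algebra.
exists [:: j], [::], [::], (fun=> B), (fun=> setT), (fun=> setT).
split => //; first by rewrite /= pj.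
by apply/seteqP; split => [w Bw|w [/(_ j (mem_head _ _))]//]; split => // k;
  rewrite inE => /eqP->.
Qed.

Lemma measurable_cylinders_xi1 (p0 p1 p2 : pred I) j : p1 j ->
  measurable_fun setT (xi1 j.1 j.2 : g_sigma_algebraType (cylinders p0 p1 p2) -> X1).
Proof.
move=> pj _ B mB; rewrite setTI; apply: sub_sigma_algebra.
exists [::], [:: j], [::], (fun=> setT), (fun=> B), (fun=> setT).
split => //; first by rewrite /= pj.
by apply/seteqP; split => [w Bw|w [_ [/(_ j (mem_head _ _))]]//]; split => //;
  split => // k; rewrite inE => /eqP->.
Qed.

Lemma measurable_cylinders_xi2 (p0 p1 p2 : pred I) j : p2 j ->
  measurable_fun setT (xi2 j.1 j.2 : g_sigma_algebraType (cylinders p0 p1 p2) -> X2).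
Proof.
move=> pj _ B mB; rewrite setTI; apply: sub_sigma_algebra.
exists [::], [::], [:: j], (fun=> setT), (fun=> setT), (fun=> B).
split => //; first by rewrite /= pj.
by apply/seteqP; split => [w Bw|w [_ [_ /(_ j (mem_head _ _))]]//]; split => //;
  split => // k; rewrite inE => /eqP->.
Qed.

End Cylinders.

(** * Expectations *)

Section Expectation.
Context {R : realType} {dO : measure_display} {Omega : measurableType dO}.
Variable P : probability Omega R.
Implicit Types f h : Omega -> R.

(** A real-valued integral turns an infinite value into 0, so the bounds on expectations that follow
    establish integrability along with the inequality. *)
Definition integrable_fct f := P.-integrable setT (EFin \o f).

Lemma integrable_fctD f h : integrable_fct f -> integrable_fct h ->
  integrable_fct (fun w => f w + h w).
Proof. by move=> fi hi; exact: (@integrableD _ _ _ P setT measurableT _ _ fi hi). Qed.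

Lemma integrable_fctZ (a : R) f : integrable_fct f ->
  integrable_fct (fun w => a * f w).
Proof. by move=> fi; exact: (@integrableZl _ _ _ P setT measurableT a _ fi). Qed.

Lemma integrable_fct_cst (a : R) : integrable_fct (fun=> a).
Proof. exact: finite_measure_integrable_cst. Qed.

Lemma integrable_fct_sum (I : Type) (s : seq I) (f : I -> Omega -> R) :
  (forall i, integrable_fct (f i)) -> integrable_fct (fun w => \sum_(i <- s) f i w).
Proof.
move=> fi; elim: s => [|i s IH].
  by under eq_fun do rewrite big_nil; exact: integrable_fct_cst.
by under eq_fun do rewrite big_cons; exact: integrable_fctD.
Qed.

Lemma EFin_Rintegral f : integrable_fct f ->
  (\int[P]_w (f w)%:E = (\int[P]_w f w)%:E)%E.
Proof. by move=> fi; rewrite fineK//; exact: integrable_fin_num. Qed.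

Lemma RintegralDT f h : integrable_fct f -> integrable_fct h ->
  \int[P]_w (f w + h w) = \int[P]_w f w + \int[P]_w h w.
Proof. by move=> fi hi; rewrite RintegralD. Qed.

Lemma RintegralZT (a : R) f : integrable_fct f ->
  \int[P]_w (a * f w) = a * \int[P]_w f w.
Proof. by move=> fi; rewrite RintegralZl. Qed.

Lemma Rintegral_cstT (a : R) : \int[P]_w a = a.
Proof. by rewrite Rintegral_cst// [X in fine X]probability_setT mulr1. Qed.

Lemma Rintegral_sumT (I : Type) (s : seq I) (f : I -> Omega -> R) :
  (forall i, integrable_fct (f i)) ->
  \int[P]_w (\sum_(i <- s) f i w) = \sum_(i <- s) \int[P]_w f i w.
Proof.
move=> fi; elim: s => [|i s IH].
  by under eq_Rintegral do rewrite big_nil; rewrite Rintegral_cstT big_nil.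
under eq_Rintegral do rewrite big_cons.
by rewrite RintegralDT ?big_cons ?IH//; exact: integrable_fct_sum.
Qed.

Lemma integrable_fct_ge0_le f (K : \bar R) : measurable_fun setT f ->
  (forall w, 0 <= f w) -> (\int[P]_w (f w)%:E <= K)%E -> (K < +oo)%E ->
  integrable_fct f.
Proof.
move=> mf f0 fK K_lty; apply/integrableP; split; first exact/measurable_EFinP.
apply: le_lt_trans K_lty; apply: le_trans fK; rewrite le_eqVlt; apply/orP; left.
by apply/eqP; apply: eq_integral => w _ /=; rewrite ger0_norm.
Qed.

Lemma integrable_fct_dom f h : measurable_fun setT f -> integrable_fct h ->
  (forall w, 0 <= f w <= h w) ->
  integrable_fct f /\ \int[P]_w f w <= \int[P]_w h w.
Proof.
move=> mf hi fh.
have fi : integrable_fct f.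
  apply: (integrable_fct_ge0_le f (\int[P]_w (h w)%:E)) => //.
  - by move=> w; have /andP[] := fh w.
  - have /integrableP[mh _] := hi.
    apply: ge0_le_integral => //.
    + by move=> w _; rewrite lee_fin; have /andP[] := fh w.
    + exact/measurable_EFinP.
    + by move=> w _; rewrite lee_fin; have /andP[] := fh w.
  - by rewrite EFin_Rintegral// ltry.
split => //; apply: le_Rintegral => // w _.
by have /andP[] := fh w.
Qed.

Lemma integrable_fct_int_le f h : measurable_fun setT f -> (forall w, 0 <= f w) ->
  integrable_fct h -> (\int[P]_w (f w)%:E <= \int[P]_w (h w)%:E)%E ->
  integrable_fct f /\ \int[P]_w f w <= \int[P]_w h w.
Proof.
move=> mf f0 hi fh.
have fi : integrable_fct f.
  by apply: (integrable_fct_ge0_le f _ mf f0 fh); rewrite EFin_Rintegral// ltry.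
by split => //; rewrite -lee_fin -!EFin_Rintegral.
Qed.

Lemma integrable_fct_dom2 f h1 h2 (a b : R) : measurable_fun setT f ->
  integrable_fct h1 -> integrable_fct h2 ->
  (forall w, 0 <= f w <= a * h1 w + b * h2 w) ->
  integrable_fct f /\ \int[P]_w f w <= a * \int[P]_w h1 w + b * \int[P]_w h2 w.
Proof.
move=> mf i1 i2 fh; have j1 := integrable_fctZ a _ i1.
have j2 := integrable_fctZ b _ i2.
rewrite -!RintegralZT// -RintegralDT//.
by apply: integrable_fct_dom => //; exact: integrable_fctD.
Qed.

Lemma integrable_fct_dom3 f h1 h2 h3 (a b c : R) : measurable_fun setT f ->
  integrable_fct h1 -> integrable_fct h2 -> integrable_fct h3 ->
  (forall w, 0 <= f w <= a * h1 w + b * h2 w + c * h3 w) ->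
  integrable_fct f /\ \int[P]_w f w
    <= a * \int[P]_w h1 w + b * \int[P]_w h2 w + c * \int[P]_w h3 w.
Proof.
move=> mf i1 i2 i3 fh; have j1 := integrable_fctZ a _ i1.
have j2 := integrable_fctZ b _ i2; have j3 := integrable_fctZ c _ i3.
have j12 := integrable_fctD _ _ j1 j2.
rewrite -!RintegralZT// -RintegralDT// -RintegralDT//.
by apply: integrable_fct_dom => //; exact: integrable_fctD.
Qed.

End Expectation.

(** * One random call with its input frozen *)

Section Oracle.
Context {R : realType} {dZ : measure_display} {Z : measurableType dZ} {d : nat}.
Variables (PZ : probability Z R) (g : Z -> 'rV[R]_d -> 'rV[R]_d)
  (gf : 'rV[R]_d -> 'rV[R]_d) (sigma : R).
Hypothesis ora : stoch_oracle PZ g gf sigma.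
Hypothesis mg : seeded_measurable g.

(** Unbiasedness annihilates the cross term between [v] and the noise. The free vector [v] later
    receives everything that does not depend on this seed. *)
Lemma oracle_noise_le (x v : 'rV[R]_d) (c : R) :
  (\int[PZ]_z (sqnorm (v + c *: (g z x - gf x)))%:E
    <= (sqnorm v + c ^+ 2 * sigma ^+ 2)%:E)%E.
Proof.
have [gk var] := ora x.
pose u z := g z x - gf x.
have mu : rvec_measurable u.
  apply: rvec_measurableB; last exact: rvec_measurable_cst.
  by apply: (mg _ Z id (fun=> x)) => //; exact: rvec_measurable_cst.
have ui k : integrable_fct PZ (fun z => u z ord0 k).
  under eq_fun do rewrite !mxE.
  apply: integrable_fctD; last exact: integrable_fct_cst.
  by have [] := gk k.
have u0 k : \int[PZ]_z u z ord0 k = 0.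
  under eq_Rintegral do rewrite !mxE.
  have [gi gE] := gk k.
  rewrite RintegralDT//; last exact: integrable_fct_cst.
  by rewrite Rintegral_cstT /Rintegral gE subrr.
have di : integrable_fct PZ (fun z => dotv v (u z)).
  by apply: integrable_fct_sum => k; exact: integrable_fctZ.
have d0 : \int[PZ]_z dotv v (u z) = 0.
  rewrite Rintegral_sumT; last by move=> k; exact: integrable_fctZ.
  by rewrite big1// => k _; rewrite RintegralZT// u0 mulr0.
have si : integrable_fct PZ (fun z => sqnorm (u z)).
  apply: (integrable_fct_ge0_le _ _ _ _ _ var); last exact: ltry.
    exact: measurable_sqnorm.
  by move=> z; exact: sqnorm_ge0.
have sE : \int[PZ]_z sqnorm (u z) <= sigma ^+ 2.
  by rewrite -lee_fin -EFin_Rintegral.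
have E z : sqnorm (v + c *: (g z x - gf x))
    = (sqnorm v + (2 * c) * dotv v (u z)) + c ^+ 2 * sqnorm (u z).
  by rewrite sqnormD sqnormZ dotvZr /u; ring.
under eq_integral do rewrite E.
have i1 : integrable_fct PZ (fun z => sqnorm v + (2 * c) * dotv v (u z)).
  by apply: integrable_fctD; [exact: integrable_fct_cst|exact: integrable_fctZ].
have i2 : integrable_fct PZ (fun z => c ^+ 2 * sqnorm (u z)) by exact: integrable_fctZ.
rewrite EFin_Rintegral; last exact: integrable_fctD.
rewrite RintegralDT// RintegralDT; [|exact: integrable_fct_cst|exact: integrable_fctZ].
rewrite Rintegral_cstT !RintegralZT// d0 mulr0 addr0 lee_fin.
by rewrite lerD2l ler_wpM2l ?sqr_ge0.
Qed.

End Oracle.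

Section FreezeOracle.
Context {R : realType} {dO dX : measure_display}
  {Omega : measurableType dO} {X : measurableType dX} {d : nat}.
Variables (P : probability Omega R) (PX : probability X R) (xi : Omega -> X).
Variable G : set (set Omega).
Hypothesis mxi : measurable_fun setT xi.
Hypothesis Gm : G `<=` measurable.
Hypothesis GI : setI_closed G.
Hypothesis GT : G setT.
Hypothesis indepG : forall A B, G A -> measurable B ->
  P (A `&` xi @^-1` B) = (P A * PX B)%E.
Local Notation OG := (g_sigma_algebraType G).

Lemma rvec_measurable_g_sigma (V : Omega -> 'rV[R]_d) :
  rvec_measurable (V : OG -> _) -> rvec_measurable V.
Proof.
move=> mV k _ B mB; rewrite setTI; apply: (g_sigma_measurable _ Gm).
by have := mV k measurableT B mB; rewrite setTI.
Qed.

(** Measurability of [V] over [OG] says that the compressed vector is determined by the other seeds;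
    for each frozen value the contraction hypothesis applies. *)
Lemma contractive_freeze (C : X -> 'rV[R]_d -> 'rV[R]_d) (delta : R)
    (V : Omega -> 'rV[R]_d) :
  contractive PX C delta -> seeded_measurable C ->
  rvec_measurable (V : OG -> _) -> integrable_fct P (fun w => sqnorm (V w)) ->
  integrable_fct P (fun w => sqnorm (C (xi w) (V w) - V w)) /\
  \int[P]_w sqnorm (C (xi w) (V w) - V w) <= (1 - delta) * \int[P]_w sqnorm (V w).
Proof.
move=> cC mC mV iV.
have mV' := rvec_measurable_g_sigma _ mV.
rewrite -RintegralZT//; apply: integrable_fct_int_le.
- by apply/measurable_sqnorm/rvec_measurableB => //; exact: mC.
- by move=> w; exact: sqnorm_ge0.
- exact: integrable_fctZ.
- have mV2 : rvec_measurable (fun z : X * OG => V z.2).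
    by move=> k; exact: (measurableT_comp (mV k) measurable_snd).
  apply: (integral_freeze_le P PX xi G mxi Gm GI GT indepG
    (fun z => sqnorm (C z.1 (V z.2) - V z.2)) (fun w => (1 - delta) * sqnorm (V w))).
  + by apply/measurable_sqnorm/rvec_measurableB => //; exact: mC.
  + by move=> z; exact: sqnorm_ge0.
  + by apply: measurable_funM => //; exact: measurable_sqnorm.
  + by move=> w; exact: (cC (V w)).
Qed.

(** Both the query point [Y] and the offset [V] are determined by the other seeds, so the fresh
    noise is orthogonal to [V] in expectation. *)
Lemma oracle_freeze (g : X -> 'rV[R]_d -> 'rV[R]_d) (gf : 'rV[R]_d -> 'rV[R]_d)
    (sigma c : R) (Y V : Omega -> 'rV[R]_d) :
  stoch_oracle PX g gf sigma -> seeded_measurable g ->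
  rvec_measurable (Y : OG -> _) -> rvec_measurable (fun w : OG => gf (Y w)) ->
  rvec_measurable (V : OG -> _) -> integrable_fct P (fun w => sqnorm (V w)) ->
  integrable_fct P (fun w => sqnorm (V w + c *: (g (xi w) (Y w) - gf (Y w)))) /\
  \int[P]_w sqnorm (V w + c *: (g (xi w) (Y w) - gf (Y w)))
    <= \int[P]_w sqnorm (V w) + c ^+ 2 * sigma ^+ 2.
Proof.
move=> og mg mY mgf mV iV.
have mV' := rvec_measurable_g_sigma _ mV.
have mY' := rvec_measurable_g_sigma _ mY.
have mgf' := rvec_measurable_g_sigma _ mgf.
rewrite -[X in _ + X](Rintegral_cstT P) -RintegralDT//; last exact: integrable_fct_cst.
apply: integrable_fct_int_le.
- apply/measurable_sqnorm/rvec_measurableD => //; apply: rvec_measurableZ.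
  by apply: rvec_measurableB => //; exact: mg.
- by move=> w; exact: sqnorm_ge0.
- by apply: integrable_fctD => //; exact: integrable_fct_cst.
- have m2 (U : Omega -> 'rV[R]_d) : rvec_measurable (U : OG -> _) ->
      rvec_measurable (fun z : X * OG => U z.2).
    by move=> mU k; exact: (measurableT_comp (mU k) measurable_snd).
  apply: (integral_freeze_le P PX xi G mxi Gm GI GT indepG
    (fun z => sqnorm (V z.2 + c *: (g z.1 (Y z.2) - gf (Y z.2))))
    (fun w => sqnorm (V w) + c ^+ 2 * sigma ^+ 2)).
  + apply/measurable_sqnorm/rvec_measurableD; first exact: m2.
    apply/rvec_measurableZ/rvec_measurableB; last exact: m2 mgf.
    by apply: mg => //; exact: m2.
  + by move=> z; exact: sqnorm_ge0.
  + by apply: measurable_funD => //; exact: measurable_sqnorm.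
  + by move=> w; exact: (oracle_noise_le PX g gf sigma og mg (Y w) (V w) c).
Qed.

End FreezeOracle.

(** * The Lyapunov recursion *)

(* The weight [a] lets the contraction [p / 2] of [E] absorb [10 l gamma^3 E]; the
   weight [b] lets the contraction [q / 4] of [G] absorb [a (2 / p) G]. *)
Lemma lyapunov_step {R : realFieldType} (X E G F X' E' G' : R)
    (p q gamma l mu L2 s2 v a b : R) :
  0 < p <= 1 -> 0 < q <= 1 -> 0 < gamma -> 0 < l -> 0 < mu -> mu <= 2 * l ->
  512 * (gamma * l) <= p * q -> 512 ^+ 2 * (gamma ^+ 2 * L2) <= (p * q) ^+ 2 ->
  0 <= L2 -> 0 <= s2 -> 0 <= E -> 0 <= E' -> 0 <= G -> 0 <= F ->
  X' + gamma * F <= (1 - gamma * mu / 2) * X + 10 * l * gamma ^+ 3 * E + v ->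
  E' <= (1 - p / 2) * E + 2 / p * G ->
  G' <= (1 - q / 2) * G + 7 / q * s2 + 6 / q * (L2 * (3 * gamma ^+ 2 *
            (E + E' + (4 * l * F + s2)))) ->
  a = 80 * l * gamma ^+ 3 / p -> b = 1280 * l * gamma ^+ 3 / (p ^+ 2 * q) ->
  X' + a * E' + b * G' + gamma / 2 * F <= (1 - gamma * mu / 2) * (X + a * E + b * G)
    + (v + 10240 * l * gamma ^+ 3 / (p * q) ^+ 2 * s2).
Proof.
move=> /andP[p0 p1] /andP[q0 q1] g0 l0 mu0 mu_le_2l gl16 gL L20 s20 E0 E0' G0 F0 HX HE HG aE0 bE0.
pose k := l * gamma ^+ 3; pose m := gamma ^+ 2 * L2.
pose r := p^-1; pose s := q^-1.
have rp : r * p = 1 by rewrite /r mulVf// gt_eqF.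
have sq : s * q = 1 by rewrite /s mulVf// gt_eqF.
have r1 : 1 <= r by rewrite /r invf_ge1.
have s1 : 1 <= s by rewrite /s invf_ge1.
have r0 : 0 < r by rewrite invr_gt0.
have s0 : 0 < s by rewrite invr_gt0.
have k0 : 0 < k by rewrite mulr_gt0// exprn_gt0.
have m0 : 0 <= m by rewrite mulr_ge0// sqr_ge0.
have aE : a = 80 * k * r by rewrite aE0 /k /r; ring.
have bE : b = 1280 * k * r ^+ 2 * s.
  by rewrite bE0 /k /r /s invfM exprVn; ring.
have cE : 10240 * l * gamma ^+ 3 / (p * q) ^+ 2 * s2 = 10240 * k * r ^+ 2 * s ^+ 2 * s2.
  by rewrite exprMn invfM /k /r /s -!exprVn; ring.
have kr0 : 0 < k * r by rewrite mulr_gt0.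
have krs0 : 0 < k * r ^+ 2 * s by rewrite !mulr_gt0// exprn_gt0.
have a0 : 0 < a by clear - aE kr0; lra.
have b0 : 0 < b by clear - bE krs0; lra.
have pq1 : p * q <= 1 by rewrite -[leRHS]mulr1 ler_pM// ltW.
have pq0 : 0 < p * q by rewrite mulr_gt0.
(* The quantity [s * m] is the coefficient [gamma^2 L2 / q] of the drift in the recursion of [G];
   the stepsize condition makes it this small. *)
have sm : 512 ^+ 2 * (s * m) <= p ^+ 2 * q.
  have -> : p ^+ 2 * q = s * (p * q) ^+ 2.
    transitivity (p ^+ 2 * q * (s * q)); first by rewrite sq mulr1.
    by ring.
  by rewrite mulrCA ler_pM2l; [exact: gL|].
have E2 : E' <= E + 2 * r * G.
  apply: le_trans HE _; rewrite -/r lerD2r mulrBl mul1r gerBl.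
  by rewrite mulr_ge0// divr_ge0// ltW.
(* Replacing [E'] by its bound feeds [G] back into its own recursion. The small drift coefficient
   makes this cost less than half of the contraction, leaving [q / 4], and raises the noise constant
   from 7 to at most 8. *)
have HG' : G' <= (1 - q / 4) * G + 8 * s * s2 + 36 / 512 ^+ 2 * (p ^+ 2 * q) * E
    + 72 * (s * m) * l * F.
  have sm0 : 0 <= s * m by rewrite mulr_ge0// ltW.
  have e0 : 0 <= E + E' + s2 by rewrite !addr_ge0.
  have h1 : s * m * (E + E' + s2) <= p ^+ 2 * q / 512 ^+ 2 * (2 * E + 2 * r * G + s2).
    by apply: ler_pM; [exact: sm0|exact: e0|clear - sm; lra|clear - E2; lra].
  have h2 : p ^+ 2 * q * (r * G) = (r * p) * (p * q * G) by ring.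
  rewrite rp mul1r in h2.
  have h3 : p * q * G <= q * G by rewrite ler_wpM2r// ler_piMl// ltW.
  have h4 : p ^+ 2 * q * s2 <= s * s2.
    rewrite ler_wpM2r//; apply: le_trans s1.
    by rewrite expr2 -mulrA mulr_ile1// ?mulr_ge0// ltW.
  have h5 : 6 * s * (L2 * (3 * gamma ^+ 2 * (E + E' + (4 * l * F + s2))))
    = 18 * (s * m * (E + E' + s2)) + 72 * (s * m) * l * F by rewrite /m; ring.
  have h6 : 0 <= q * G by rewrite mulr_ge0// ltW.
  have h7 : 0 <= p ^+ 2 * q * E by rewrite !mulr_ge0// ltW// exprn_gt0.
  have h8 : 0 <= s * s2 by rewrite mulr_ge0// ltW.
  rewrite -/s h5 in HG; clear - HG h1 h2 h3 h4 h6 h7 h8; lra.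
have gmu : gamma * mu <= p * q / 256.
  have h : gamma * mu <= gamma * (2 * l) by rewrite ler_pM2l.
  clear - h gl16; lra.
have kE : 0 <= k * E by rewrite mulr_ge0// ltW.
(* The Lyapunov function is to contract at rate [1 - gamma mu / 2] in every component; this and [tG]
   are the price for [E] and [G]. *)
have tE : 80 * k * r * (gamma * mu / 2) * E <= k * E.
  have h : k * E * r * (gamma * mu) <= k * E * r * (p * q / 256).
    by rewrite ler_wpM2l// !mulr_ge0// ltW.
  have h' : k * E * r * (p * q / 256) = k * E * (r * p) * (q / 256) by ring.
  have h'' : k * E * q <= k * E by rewrite ler_piMr// mulr_ge0// ltW.
  rewrite h' rp in h; clear - h h'' kE; lra.
have tG : b * (gamma * mu / 2) * G <= 3 * (k * r ^+ 2 * G).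
  have krG0 : 0 <= k * r ^+ 2 * G by rewrite !mulr_ge0// ?exprn_ge0// ltW.
  have h : k * r ^+ 2 * G * s * (gamma * mu) <= k * r ^+ 2 * G * s * (p * q / 256).
    by rewrite ler_wpM2l// mulr_ge0// ltW.
  have h' : k * r ^+ 2 * G * s * (p * q / 256) = k * r ^+ 2 * G * (s * q) * (p / 256).
    by ring.
  have h'' : k * r ^+ 2 * G * p <= k * r ^+ 2 * G by rewrite ler_piMr.
  rewrite h' sq in h; rewrite bE; clear - h h'' krG0; lra.
(* The drift returns function gap through [G]; half of the decrease [gamma F] pays for it, which is
   why only [gamma / 2 * F] survives. *)
have tF : b * (72 * (s * m) * l * F) <= gamma / 2 * F.
  have gl0 : 0 <= gamma * l by rewrite mulr_ge0// ltW.
  have gl1 : gamma * l <= 512^-1 by clear - gl16 pq1; lra.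
  have u3 := ler_pM gl0 gl0 gl1 gl1.
  have y0 : 0 <= (r * s) ^+ 2 * m by rewrite mulr_ge0// sqr_ge0.
  have y1 : (r * s) ^+ 2 * m <= (512 ^+ 2)^-1.
    have := ler_wpM2l (sqr_ge0 (r * s)) gL.
    have -> : (r * s) ^+ 2 * (p * q) ^+ 2 = 1.
      by rewrite -exprMn mulrACA rp sq mulr1 expr1n.
    rewrite -/m => h; clear - h; lra.
  have u4 := ler_pM (mulr_ge0 gl0 gl0) y0 u3 y1.
  have gF0 : 0 <= gamma * F by rewrite mulr_ge0// ltW.
  have u5 := ler_wpM2l gF0 u4.
  have -> : b * (72 * (s * m) * l * F)
    = 1280 * 72 * (gamma * F * (gamma * l * (gamma * l) * ((r * s) ^+ 2 * m))).
    by rewrite bE /k; ring.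
  clear - u5 gF0; lra.
have bs : b * (q / 4 * G) = 320 * k * r ^+ 2 * G.
  rewrite bE; transitivity (320 * k * r ^+ 2 * G * (s * q)); first by field.
  by rewrite sq mulr1.
have bp : b * (36 / 512 ^+ 2 * (p ^+ 2 * q) * E) = 1280 * 36 / 512 ^+ 2 * k * E.
  rewrite bE; transitivity (1280 * 36 / 512 ^+ 2 * k * E * ((r * p) ^+ 2 * (s * q))).
    by ring.
  by rewrite rp sq expr1n !mulr1.
have bn : b * (8 * s * s2) = 10240 * k * r ^+ 2 * s ^+ 2 * s2 by rewrite bE; ring.
have ap : a * (p / 2 * E) = 40 * k * E.
  rewrite aE; transitivity (40 * k * E * (r * p)); first by field.
  by rewrite rp mulr1.
have aG : a * (2 * r * G) = 160 * k * r ^+ 2 * G by rewrite aE; ring.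
have HE' : a * E' <= a * E - a * (p / 2 * E) + a * (2 * r * G).
  have h := ler_wpM2l (ltW a0) HE; rewrite -/r in h; clear - h; lra.
have HGb : b * G' <= b * G - b * (q / 4 * G) + b * (8 * s * s2)
    + b * (36 / 512 ^+ 2 * (p ^+ 2 * q) * E) + b * (72 * (s * m) * l * F).
  have h := ler_wpM2l (ltW b0) HG'; clear - h; lra.
have HX' : X' + gamma * F <= (1 - gamma * mu / 2) * X + 10 * k * E + v.
  by move: HX; rewrite /k !mulrA.
have tE' : a * (gamma * mu / 2) * E <= k * E by rewrite aE.
have krG : 0 <= k * r ^+ 2 * G by rewrite !mulr_ge0// ?exprn_ge0// ltW.
(* In units of [k E] the contraction 40 beats [10 + 1280 * 36 / 512^2 + 1]; in units of [k r^2 G]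
   the contraction 320 beats [160 + 3]. *)
rewrite cE; rewrite ap aG in HE'; rewrite bs bp bn in HGb.
clear - HX' HE' HGb tE' tG tF kE krG; lra.
Qed.

(** Multiplied by [rho^-(t+1)], the recursion telescopes in [rho^-t * Psi t]. *)
Lemma weighted_sum_recursion {R : realFieldType} (rho N c : R) (Psi F : nat -> R) :
  0 < rho -> (forall t, Psi t.+1 + c * F t <= rho * Psi t + N) ->
  forall T, rho ^- T.+1 * Psi T.+1 + c * \sum_(t < T.+1) rho ^- t.+1 * F t
    <= Psi 0 + N * \sum_(t < T.+1) rho ^- t.+1.
Proof.
move=> rho0 rec.
have step t : rho ^- t.+1 * Psi t.+1 + c * (rho ^- t.+1 * F t)
    <= rho ^- t * Psi t + N * rho ^- t.+1.
  have w0 : 0 <= rho ^- t.+1 by rewrite invr_ge0 exprn_ge0// ltW.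
  have := ler_wpM2l w0 (rec t).
  have -> : rho ^- t.+1 * (rho * Psi t + N) = rho ^- t * Psi t + N * rho ^- t.+1.
    by rewrite exprS invfM; field; rewrite expf_neq0 gt_eqF.
  by rewrite mulrDr mulrCA.
elim=> [|T IH].
  by rewrite !big_ord1; have := step 0%N; rewrite expr0 invr1 mul1r.
rewrite big_ord_recr [in X in _ <= X]big_ord_recr /= !mulrDr.
have := step T.+1; lra.
Qed.

(** * The algorithm *)

Section Avgv.
Context {R : realType} {n d : nat}.
Implicit Types u v : 'I_n -> 'rV[R]_d.

Lemma avgvD u v : avgv (fun i => u i + v i) = avgv u + avgv v.
Proof. by rewrite /avgv big_split scalerDr. Qed.

Lemma avgvN v : avgv (fun i => - v i) = - avgv v.
Proof. by rewrite /avgv sumrN scalerN. Qed.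

Lemma avgv0 : avgv (fun _ : 'I_n => 0 : 'rV[R]_d) = 0.
Proof. by rewrite /avgv big1// scaler0. Qed.

End Avgv.

(** Neighbourhoods of row vectors are sup-norm ones while the Lipschitz bound is Euclidean, which
    costs a factor [d] in the squared norm. The constant [M] uses [|L| + 1] and [d + 1] to be
    positive and to make the final inequality strict. *)
Lemma lipschitz_coord_continuous {R : realType} {d : nat}
    (gf : 'rV[R]_d -> 'rV[R]_d) (L : R) (k : 'I_d) :
  (forall x y, sqnorm (gf x - gf y) <= L ^+ 2 * sqnorm (x - y)) ->
  continuous (fun x => gf x ord0 k).
Proof.
move=> Lgf x; have F := nbhs_filter x; apply/cvgrPdist_lt => e e0.
pose M : R := (`|L| + 1) * d.+1%:R.
have M0 : 0 < M by rewrite mulr_gt0// ?ltr0n// ltr_wpDl.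
have r0 : 0 < e / M by rewrite divr_gt0.
exists (fun i j => ball (x i j) (e / M)) => [i j /=|y bxy]; first exact: nbhsx_ballx.
rewrite -(ltr_pXn2r (n := 2))// ?nnegrE ?normr_ge0 ?(ltW e0)//.
have -> : `|gf x ord0 k - gf y ord0 k| ^+ 2 = (gf x - gf y) ord0 k ^+ 2.
  by rewrite real_normK ?num_real// !mxE.
apply: le_lt_trans (sqr_coord_le _ _) _; apply: le_lt_trans (Lgf _ _) _.
have h : sqnorm (x - y) <= d%:R * (e / M) ^+ 2.
  rewrite mulr_natl -[d in _ *+ d]card_ord -sumr_const.
  apply: ler_sum => i _; rewrite -expr2 -[leLHS]real_normK ?num_real//.
  rewrite ler_pXn2r ?nnegrE ?normr_ge0 ?(ltW r0)//.
  by have := bxy ord0 i; rewrite /ball/= !mxE => /ltW.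
apply: (@le_lt_trans _ _ (L ^+ 2 * (d%:R * (e / M) ^+ 2))).
  by rewrite ler_wpM2l ?sqr_ge0.
have -> : L ^+ 2 * (d%:R * (e / M) ^+ 2) = (L ^+ 2 * d%:R) * (e ^+ 2 / M ^+ 2).
  by rewrite expr_div_n; ring.
rewrite mulrCA -[ltRHS]mulr1 ltr_pM2l ?exprn_gt0//.
rewrite ltr_pdivrMr ?exprn_gt0// mul1r /M exprMn.
have dd : d%:R < (d.+1%:R : R) ^+ 2.
  by rewrite -natrX ltr_nat -mulnn leq_pmulr.
have LL : L ^+ 2 <= (`|L| + 1) ^+ 2.
  rewrite -[leLHS]real_normK ?num_real// ler_pXn2r ?nnegrE ?addr_ge0// lerDl.
  exact: ler01.
apply: (@le_lt_trans _ _ ((`|L| + 1) ^+ 2 * d%:R)).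
  by rewrite ler_wpM2r.
by rewrite ltr_pM2l// exprn_gt0// ltr_wpDl.
Qed.

Lemma lipschitz_rvec_measurable {R : realType} {d : nat}
    (gf : 'rV[R]_d -> 'rV[R]_d) (L : R)
    {dT : measure_display} {T : measurableType dT} (V : T -> 'rV[R]_d) :
  (forall x y, sqnorm (gf x - gf y) <= L ^+ 2 * sqnorm (x - y)) ->
  rvec_measurable V -> rvec_measurable (fun w => gf (V w)).
Proof.
move=> Lgf mV k.
by apply: (measurable_continuous_comp (fun x => gf x ord0 k)) => //;
  exact: lipschitz_coord_continuous Lgf.
Qed.

(** Membership in [s] matters when one client's seed is frozen: that client's own summand is not
    measurable, and [s] leaves it out. *)
Lemma rvec_measurable_sum_in {R : realType} {d : nat} {dT : measure_display}
    {T : measurableType dT} (I : eqType) (s : seq I) (V : I -> T -> 'rV[R]_d) :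
  {in s, forall i, rvec_measurable (V i)} ->
  rvec_measurable (fun w => \sum_(i <- s) V i w).
Proof.
elim: s => [|i s IH] mV.
  by under eq_fun do rewrite big_nil; exact: rvec_measurable_cst.
under eq_fun do rewrite big_cons; apply: rvec_measurableD.
  exact/mV/mem_head.
by apply: IH => j js; apply: mV; rewrite inE js orbT.
Qed.

(** * Measurability of the trajectory *)

Section TrajMeasurable.
Context {R : realType} {n d : nat} {dZ dX1 dX2 dT : measure_display}
  {Z : measurableType dZ} {X1 : measurableType dX1} {X2 : measurableType dX2}
  {T : measurableType dT}.
Variables (gamma : R) (x0 : 'rV[R]_d) (g : 'I_n -> Z -> 'rV[R]_d -> 'rV[R]_d)
  (C1 : X1 -> 'rV[R]_d -> 'rV[R]_d) (C2 : X2 -> 'rV[R]_d -> 'rV[R]_d)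
  (zeta : nat -> 'I_n -> T -> Z) (xi1 : nat -> 'I_n -> T -> X1)
  (xi2 : nat -> 'I_n -> T -> X2).
Hypothesis mg : forall i, seeded_measurable (g i).
Hypothesis mC1 : seeded_measurable C1.
Hypothesis mC2 : seeded_measurable C2.

(** State [t] reads oracle seeds up to index [t], since index 0 is the initial call, but compressor
    seeds only below [t]. The space [T] is arbitrary so that coarser sigma-algebras on the sample
    space are covered too. *)
Lemma alg_traj_measurable t :
  (forall s i, (s <= t)%N -> measurable_fun setT (zeta s i)) ->
  (forall s i, (s < t)%N -> measurable_fun setT (xi1 s i)) ->
  (forall s i, (s < t)%N -> measurable_fun setT (xi2 s i)) ->
  let traj := alg_traj gamma x0 g C1 C2 zeta xi1 xi2 in
  [/\ rvec_measurable (fun w => st_x (traj t w)),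
      forall i, rvec_measurable (fun w => st_e (traj t w) i),
      forall i, rvec_measurable (fun w => st_hi (traj t w) i)
    & rvec_measurable (fun w => st_h (traj t w))].
Proof.
elim: t => [|t IH] mz m1 m2 traj.
  have mh i : rvec_measurable (fun w => g i (zeta 0 i w) x0).
    by apply: mg; [exact: mz|exact: rvec_measurable_cst].
  split=> /=.
  - exact: rvec_measurable_cst.
  - by move=> i; exact: rvec_measurable_cst.
  - exact: mh.
  - exact: rvec_measurable_avgv.
have [mx me mhi mh] : [/\ rvec_measurable (fun w => st_x (traj t w)),
      forall i, rvec_measurable (fun w => st_e (traj t w) i),
      forall i, rvec_measurable (fun w => st_hi (traj t w) i)
    & rvec_measurable (fun w => st_h (traj t w))].
  apply: IH => s i st.
  - exact/mz/leqW.
  - exact/m1/leqW.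
  - exact/m2/leqW.
have mgt i : rvec_measurable (fun w => g i (zeta t.+1 i w) (st_x (traj t w))).
  by apply: mg => //; exact: mz.
have mV i : rvec_measurable (fun w => st_e (traj t w) i +
    g i (zeta t.+1 i w) (st_x (traj t w)) - st_hi (traj t w) i).
  by apply: rvec_measurableB => //; exact: rvec_measurableD.
have mD i : rvec_measurable (fun w => C1 (xi1 t i w) (st_e (traj t w) i +
    g i (zeta t.+1 i w) (st_x (traj t w)) - st_hi (traj t w) i)).
  by apply: mC1 => //; exact: m1.
have mDh i : rvec_measurable (fun w => C2 (xi2 t i w)
    (g i (zeta t.+1 i w) (st_x (traj t w)) - st_hi (traj t w) i)).
  by apply: mC2; [exact: m2|exact: rvec_measurableB].
split=> /=.
- apply: rvec_measurableB; first by apply: rvec_measurableB => //; exact: rvec_measurableZ.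
  exact/rvec_measurableZ/rvec_measurable_sum.
- by move=> i; exact: rvec_measurableB.
- by move=> i; exact: rvec_measurableD.
- by apply: rvec_measurableD => //; exact/rvec_measurableZ/rvec_measurable_sum.
Qed.

End TrajMeasurable.

(** * Random quantities of the algorithm and their recursions *)

Section Process.
Context {R : realType} {n d : nat} {dO dZ dX1 dX2 : measure_display}
  {Omega : measurableType dO} {Z : measurableType dZ}
  {X1 : measurableType dX1} {X2 : measurableType dX2}.
Variables (P : probability Omega R) (PZ : 'I_n -> probability Z R)
  (PX1 : probability X1 R) (PX2 : probability X2 R)
  (gfi : 'I_n -> 'rV[R]_d -> 'rV[R]_d)
  (Li : 'I_n -> R) (sigma delta1 delta2 gamma : R) (x0 : 'rV[R]_d)
  (g : 'I_n -> Z -> 'rV[R]_d -> 'rV[R]_d)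
  (C1 : X1 -> 'rV[R]_d -> 'rV[R]_d) (C2 : X2 -> 'rV[R]_d -> 'rV[R]_d)
  (zeta : nat -> 'I_n -> Omega -> Z)
  (xi1 : nat -> 'I_n -> Omega -> X1) (xi2 : nat -> 'I_n -> Omega -> X2).
Hypothesis n0 : (0 < n)%N.
Hypothesis Lgfi : forall i x y,
  sqnorm (gfi i x - gfi i y) <= Li i ^+ 2 * sqnorm (x - y).
Hypothesis d1 : 0 < delta1 <= 1.
Hypothesis d2 : 0 < delta2 <= 1.
Hypothesis cC1 : contractive PX1 C1 delta1.
Hypothesis cC2 : contractive PX2 C2 delta2.
Hypothesis mC1 : seeded_measurable C1.
Hypothesis mC2 : seeded_measurable C2.
Hypothesis og : forall i, stoch_oracle (PZ i) (g i) (gfi i) sigma.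
Hypothesis mg : forall i, seeded_measurable (g i).
Hypothesis fresh : fresh_seeds P PZ PX1 PX2 zeta xi1 xi2.

Let traj := alg_traj gamma x0 g C1 C2 zeta xi1 xi2.

Definition xt t w := st_x (traj t w).
Definition et t i w := st_e (traj t w) i.
Definition ht t i w := st_hi (traj t w) i.
Definition gt t i w := g i (zeta t.+1 i w) (xt t w).
Definition gradf x := avgv (fun i => gfi i x).
Definition virt t w := xt t w - gamma *: avgv (fun i => et t i w).

Lemma traj_h t w : st_h (traj t w) = avgv (fun i => ht t i w).
Proof. by elim: t => [//|t IH]; rewrite /= /ht/= avgvD -/(traj t w) IH. Qed.

Definition Delta t i w := C1 (xi1 t i w) (et t i w + gt t i w - ht t i w).

Lemma xt_succ t w : xt t.+1 w =
  xt t w - gamma *: avgv (fun i => ht t i w) - gamma *: avgv (fun i => Delta t i w).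
Proof. by rewrite {1}/xt /= -/(traj t w) traj_h -scalerA. Qed.

Lemma avg_et_succ t w : avgv (fun i => et t.+1 i w) =
  avgv (fun i => et t i w) + avgv (fun i => gt t i w) - avgv (fun i => ht t i w)
  - avgv (fun i => Delta t i w).
Proof. by rewrite -!avgvN -!avgvD. Qed.

(** The averaged shifts and compressed messages enter [xt] and the averaged error so that they
    cancel in the virtual iterate. *)
Lemma virt_succ t w : virt t.+1 w = virt t w - gamma *: avgv (fun i => gt t i w).
Proof.
rewrite /virt xt_succ avg_et_succ.
move: (xt t w) (avgv _) (avgv _) (avgv _) (avgv _) => x a b c D.
by apply/rowP => k; rewrite !mxE; ring.
Qed.

(** Eliminating the compressed messages through the error update also removes the shifts, so the
    displacement is controlled by errors and gradients alone. *)
Lemma xt_diff t w : xt t.+1 w - xt t w =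
  - gamma *: (avgv (fun i => et t i w) - avgv (fun i => et t.+1 i w)
    + avgv (fun i => gt t i w)).
Proof.
rewrite xt_succ avg_et_succ.
move: (xt t w) (avgv _) (avgv _) (avgv _) (avgv _) => x a b c D.
by apply/rowP => k; rewrite !mxE; ring.
Qed.

Lemma mean_sqr_Li_ge0 : 0 <= n%:R^-1 * \sum_(i < n) Li i ^+ 2.
Proof. by rewrite mulr_ge0 ?invr_ge0 ?ler0n// sumr_ge0// => i _; rewrite sqr_ge0. Qed.

Definition mean_sqr_Li := n%:R^-1 * \sum_(i < n) Li i ^+ 2.

Lemma gradf_lipschitz_mean x y :
  sqnorm (gradf x - gradf y) <= mean_sqr_Li * sqnorm (x - y).
Proof.
rewrite /gradf -avgvN -avgvD; apply: le_trans (sqnorm_avgv _ _) _.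
rewrite /mean_sqr_Li -mulrA ler_wpM2l ?invr_ge0 ?ler0n// mulr_suml.
by apply: ler_sum => i _; exact: Lgfi.
Qed.

Section Measurability.
Context {dT : measure_display} {T : measurableType dT} (toO : T -> Omega).
Variable t : nat.
Hypothesis mz : forall s i, (s <= t)%N -> measurable_fun setT (fun w => zeta s i (toO w)).
Hypothesis m1 : forall s i, (s < t)%N -> measurable_fun setT (fun w => xi1 s i (toO w)).
Hypothesis m2 : forall s i, (s < t)%N -> measurable_fun setT (fun w => xi2 s i (toO w)).

Let trajE w s : alg_traj gamma x0 g C1 C2 (fun s i w => zeta s i (toO w))
    (fun s i w => xi1 s i (toO w)) (fun s i w => xi2 s i (toO w)) s w = traj s (toO w).
Proof. by elim: s => //= s ->. Qed.

(** In the applications [toO] is the identity and [T] is the sample space, either with its own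
    sigma-algebra or with the one generated by all seeds but one. *)
Lemma state_measurable : [/\ rvec_measurable (fun w => xt t (toO w)),
  forall i, rvec_measurable (fun w => et t i (toO w))
  & forall i, rvec_measurable (fun w => ht t i (toO w))].
Proof.
have [mx me mh _] := alg_traj_measurable gamma x0 g C1 C2 _ _ _ mg mC1 mC2 t mz m1 m2.
split.
- by under eq_fun do rewrite /xt -trajE; exact: mx.
- by move=> i; under eq_fun do rewrite /et -trajE; exact: me.
- by move=> i; under eq_fun do rewrite /ht -trajE; exact: mh.
Qed.

Lemma gt_measurable i : measurable_fun setT (fun w => zeta t.+1 i (toO w)) ->
  rvec_measurable (fun w => gt t i (toO w)).
Proof. by move=> mzi; have [mx _ _] := state_measurable; exact: mg. Qed.

End Measurability.

(** * Dependence of the state on individual seeds *)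

Local Notation cyl p0 p1 p2 := (g_sigma_algebraType (cylinders zeta xi1 xi2 p0 p1 p2)).

Lemma state_measurable_Omega t :
  [/\ rvec_measurable (xt t), forall i, rvec_measurable (et t i),
   forall i, rvec_measurable (ht t i) & forall i, rvec_measurable (gt t i)].
Proof.
have [m _ _ _ _] := fresh.
have mz s i : measurable_fun setT (zeta s i) by have [] := m s i.
have m1 s i : measurable_fun setT (xi1 s i) by have [_ []] := m s i.
have m2 s i : measurable_fun setT (xi2 s i) by have [_ []] := m s i.
have [mx me mh] := @state_measurable _ Omega id t (fun s i _ => mz s i)
  (fun s i _ => m1 s i) (fun s i _ => m2 s i).
split=> // i.
exact: (@gt_measurable _ Omega id t (fun s i _ => mz s i)
  (fun s i _ => m1 s i) (fun s i _ => m2 s i) i (mz _ _)).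
Qed.

Lemma state_measurable_zeta t j : (t < j.1)%N -> let T := cyl (predC1 j) predT predT in
  [/\ rvec_measurable (xt t : T -> _), forall i, rvec_measurable (et t i : T -> _),
   forall i, rvec_measurable (ht t i : T -> _)
   & forall i, (t.+1, i) != j -> rvec_measurable (gt t i : T -> _)].
Proof.
move=> tj T.
have mz s i : (s <= t)%N -> measurable_fun setT (zeta s i : T -> _).
  move=> st; apply: (measurable_cylinders_zeta _ _ _ _ _ _ (s, i)) => /=.
  by apply/eqP => e; rewrite -e /= ltnNge st in tj.
have m1 s i : (s < t)%N -> measurable_fun setT (xi1 s i : T -> _).
  by move=> _; exact: (measurable_cylinders_xi1 _ _ _ _ _ _ (s, i)).
have m2 s i : (s < t)%N -> measurable_fun setT (xi2 s i : T -> _).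
  by move=> _; exact: (measurable_cylinders_xi2 _ _ _ _ _ _ (s, i)).
have [mx me mh] := @state_measurable _ T id t mz m1 m2.
split=> // i ij.
apply: (@gt_measurable _ T id t mz m1 m2 i).
exact: (measurable_cylinders_zeta _ _ _ _ _ _ (t.+1, i)).
Qed.

(** The compressor seeds of iteration [t] first enter state [t.+1], after the gradients [gt t i] are
    drawn. *)
Lemma state_measurable_xi1 t i0 : let T := cyl predT (predC1 (t, i0)) predT in
  [/\ rvec_measurable (xt t : T -> _), forall i, rvec_measurable (et t i : T -> _),
   forall i, rvec_measurable (ht t i : T -> _)
   & forall i, rvec_measurable (gt t i : T -> _)].
Proof.
move=> T.
have mz s i : measurable_fun setT (zeta s i : T -> _).
  exact: (measurable_cylinders_zeta _ _ _ _ _ _ (s, i)).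
have m1 s i : (s < t)%N -> measurable_fun setT (xi1 s i : T -> _).
  move=> st; apply: (measurable_cylinders_xi1 _ _ _ _ _ _ (s, i)) => /=.
  by apply/eqP => -[e _]; rewrite e ltnn in st.
have m2 s i : (s < t)%N -> measurable_fun setT (xi2 s i : T -> _).
  by move=> _; exact: (measurable_cylinders_xi2 _ _ _ _ _ _ (s, i)).
have [mx me mh] := @state_measurable _ T id t (fun s i _ => mz s i) m1 m2.
split=> // i; exact: (@gt_measurable _ T id t (fun s i _ => mz s i) m1 m2 i).
Qed.

Lemma state_measurable_xi2 t i0 : let T := cyl predT predT (predC1 (t, i0)) in
  [/\ rvec_measurable (xt t : T -> _), forall i, rvec_measurable (et t i : T -> _),
   forall i, rvec_measurable (ht t i : T -> _)
   & forall i, rvec_measurable (gt t i : T -> _)].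
Proof.
move=> T.
have mz s i : measurable_fun setT (zeta s i : T -> _).
  exact: (measurable_cylinders_zeta _ _ _ _ _ _ (s, i)).
have m1 s i : (s < t)%N -> measurable_fun setT (xi1 s i : T -> _).
  by move=> _; exact: (measurable_cylinders_xi1 _ _ _ _ _ _ (s, i)).
have m2 s i : (s < t)%N -> measurable_fun setT (xi2 s i : T -> _).
  move=> st; apply: (measurable_cylinders_xi2 _ _ _ _ _ _ (s, i)) => /=.
  by apply/eqP => -[e _]; rewrite e ltnn in st.
have [mx me mh] := @state_measurable _ T id t (fun s i _ => mz s i) m1 m2.
split=> // i; exact: (@gt_measurable _ T id t (fun s i _ => mz s i) m1 m2 i).
Qed.


(** The new error is minus the compression residual of [e + g - h]. Young's inequality with weight
    [delta1 / 2] then suffices, as [(1 - delta1)(1 + delta1/2) <= 1 - delta1/2] and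
    [(1 - delta1)(1 + 2/delta1) <= 2/delta1]. *)
Lemma error_step t i :
  integrable_fct P (fun w => sqnorm (et t i w)) ->
  integrable_fct P (fun w => sqnorm (gt t i w - ht t i w)) ->
  integrable_fct P (fun w => sqnorm (et t.+1 i w)) /\
  \int[P]_w sqnorm (et t.+1 i w) <= (1 - delta1 / 2) * \int[P]_w sqnorm (et t i w)
    + 2 / delta1 * \int[P]_w sqnorm (gt t i w - ht t i w).
Proof.
move=> ie ig; have /andP[d10 d11] := d1.
have [mx me mh mgt] := state_measurable_Omega t.
have [mx' me' mh' mgt'] := state_measurable_xi1 t i.
pose V w := et t i w + gt t i w - ht t i w.
have mV : rvec_measurable V by apply: rvec_measurableB => //; exact: rvec_measurableD.
have [iV VE] : integrable_fct P (fun w => sqnorm (V w)) /\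
    \int[P]_w sqnorm (V w) <= (1 + delta1 / 2) * \int[P]_w sqnorm (et t i w)
      + (1 + (delta1 / 2)^-1) * \int[P]_w sqnorm (gt t i w - ht t i w).
  apply: integrable_fct_dom2 => //; first exact: measurable_sqnorm.
  move=> w; rewrite sqnorm_ge0/= /V -addrA; apply: sqnormD_young.
  by rewrite divr_gt0.
have [m _ _ _ _] := fresh.
have [iC CE] := contractive_freeze P PX1 (xi1 t i)
  (cylinders zeta xi1 xi2 predT (predC1 (t, i)) predT) (m t i).2.1
  (cylinders_measurable P PZ PX1 PX2 zeta xi1 xi2 fresh _ _ _)
  (cylindersI zeta xi1 xi2 _ _ _) (cylindersT zeta xi1 xi2 _ _ _)
  (cylinders_indep_xi1 P PZ PX1 PX2 zeta xi1 xi2 fresh (t, i)) C1 delta1 V cC1 mC1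
  (rvec_measurableB _ _ (rvec_measurableD _ _ (me' i) (mgt' i)) (mh' i)) iV.
have E w : sqnorm (et t.+1 i w) = sqnorm (C1 (xi1 t i w) (V w) - V w).
  by rewrite -sqnormN opprB.
under eq_fun do rewrite E.
split => //; apply: le_trans CE _.
have a0 : 0 <= \int[P]_w sqnorm (et t i w).
  by apply: Rintegral_ge0 => // w _; exact: sqnorm_ge0.
have b0 : 0 <= \int[P]_w sqnorm (gt t i w - ht t i w).
  by apply: Rintegral_ge0 => // w _; exact: sqnorm_ge0.
have := ler_wpM2l (_ : 0 <= 1 - delta1) VE.
rewrite subr_ge0 => /(_ d11) h; apply: le_trans h _.
set a := \int[P]_w _ in a0 *; set b := \int[P]_w _ in b0 *.
rewrite invf_div; set r := 2 / delta1.
have rd : r * delta1 = 2 by rewrite /r mulfVK// gt_eqF.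
have -> : (1 - delta1) * ((1 + delta1 / 2) * a + (1 + r) * b)
  = (1 - delta1 / 2 - delta1 ^+ 2 / 2) * a + (1 - delta1 + r - r * delta1) * b by field.
by rewrite rd lerD// ler_wpM2r//; have := sqr_ge0 delta1; lra.
Qed.

Lemma shift_step t i :
  integrable_fct P (fun w => sqnorm (gt t i w - ht t i w)) ->
  integrable_fct P (fun w => sqnorm (ht t.+1 i w - gt t i w)) /\
  \int[P]_w sqnorm (ht t.+1 i w - gt t i w)
    <= (1 - delta2) * \int[P]_w sqnorm (gt t i w - ht t i w).
Proof.
move=> ig.
have [mx' me' mh' mgt'] := state_measurable_xi2 t i.
have [m _ _ _ _] := fresh.
have [iC CE] := contractive_freeze P PX2 (xi2 t i)
  (cylinders zeta xi1 xi2 predT predT (predC1 (t, i))) (m t i).2.2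
  (cylinders_measurable P PZ PX1 PX2 zeta xi1 xi2 fresh _ _ _)
  (cylindersI zeta xi1 xi2 _ _ _) (cylindersT zeta xi1 xi2 _ _ _)
  (cylinders_indep_xi2 P PZ PX1 PX2 zeta xi1 xi2 fresh (t, i)) C2 delta2
  (fun w => gt t i w - ht t i w) cC2 mC2 (rvec_measurableB _ _ (mgt' i) (mh' i)) ig.
have E w : sqnorm (ht t.+1 i w - gt t i w)
    = sqnorm (C2 (xi2 t i w) (gt t i w - ht t i w) - (gt t i w - ht t i w)).
  by rewrite opprB [in RHS]addrCA addrA.
by under eq_fun do rewrite E.
Qed.

Lemma oracle_step (j : nat * 'I_n) (c : R) (Y V : Omega -> 'rV[R]_d) :
  let T := cyl (predC1 j) predT predT in
  rvec_measurable (Y : T -> _) -> rvec_measurable (V : T -> _) ->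
  integrable_fct P (fun w => sqnorm (V w)) ->
  let W w := V w + c *: (g j.2 (zeta j.1 j.2 w) (Y w) - gfi j.2 (Y w)) in
  integrable_fct P (fun w => sqnorm (W w)) /\
  \int[P]_w sqnorm (W w) <= \int[P]_w sqnorm (V w) + c ^+ 2 * sigma ^+ 2.
Proof.
move=> T mY mV iV W.
have [m _ _ _ _] := fresh.
exact: (oracle_freeze P (PZ j.2) (zeta j.1 j.2)
  (cylinders zeta xi1 xi2 (predC1 j) predT predT) (m j.1 j.2).1
  (cylinders_measurable P PZ PX1 PX2 zeta xi1 xi2 fresh _ _ _)
  (cylindersI zeta xi1 xi2 _ _ _) (cylindersT zeta xi1 xi2 _ _ _)
  (cylinders_indep_zeta P PZ PX1 PX2 zeta xi1 xi2 fresh j) (g j.2) (gfi j.2) sigma c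
  Y V (og j.2) (mg j.2) mY (lipschitz_rvec_measurable _ _ _ (Lgfi j.2) mY) mV iV).
Qed.

(** The clients' noises are added one at a time: what has been accumulated does not depend on the
    next client's seed, so variances add without cross terms. This is the source of the factor [1/n]
    in the leading noise. *)
Lemma oracle_step_sum t (c : R) (V : Omega -> 'rV[R]_d) (s : seq 'I_n) : uniq s ->
  (forall i, rvec_measurable (V : cyl (predC1 (t.+1, i)) predT predT -> _)) ->
  integrable_fct P (fun w => sqnorm (V w)) ->
  let W w := V w + c *: \sum_(i <- s) (gt t i w - gfi i (xt t w)) in
  integrable_fct P (fun w => sqnorm (W w)) /\
  \int[P]_w sqnorm (W w)
    <= \int[P]_w sqnorm (V w) + (size s)%:R * (c ^+ 2 * sigma ^+ 2).
Proof.
move=> us mV iV; elim: s us => [_|i s IH /= /andP[is_ us]].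
  by rewrite /= mul0r addr0; under eq_fun do rewrite big_nil scaler0 addr0.
have [iW WE] := IH us.
pose V' w := V w + c *: \sum_(k <- s) (gt t k w - gfi k (xt t w)).
have [mx _ _ mgt] := state_measurable_zeta t (t.+1, i) (ltnSn t).
have mV' : rvec_measurable (V' : cyl (predC1 (t.+1, i)) predT predT -> _).
  apply: rvec_measurableD; first exact: mV.
  apply/rvec_measurableZ/rvec_measurable_sum_in => k ks.
  apply: rvec_measurableB; last exact: lipschitz_rvec_measurable (Lgfi k) mx.
  by apply: mgt; apply: contra is_ => /eqP[<-].
have [iW' WE'] := oracle_step (t.+1, i) c (xt t) V' mx mV' iW.
have E w : V w + c *: \sum_(k <- i :: s) (gt t k w - gfi k (xt t w))
  = V' w + c *: (g i (zeta t.+1 i w) (xt t w) - gfi i (xt t w)).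
  by rewrite big_cons scalerDr addrA addrAC.
under eq_fun do rewrite E.
split=> //; apply: le_trans WE' _.
by rewrite -natr1 mulrDl mul1r addrA lerD2r.
Qed.


Lemma oracle_step0 (j : nat * 'I_n) (c : R) (Y : Omega -> 'rV[R]_d) :
  rvec_measurable (Y : cyl (predC1 j) predT predT -> _) ->
  let W w := c *: (g j.2 (zeta j.1 j.2 w) (Y w) - gfi j.2 (Y w)) in
  integrable_fct P (fun w => sqnorm (W w)) /\
  \int[P]_w sqnorm (W w) <= c ^+ 2 * sigma ^+ 2.
Proof.
move=> mY W.
have i0 : integrable_fct P (fun=> sqnorm (0 : 'rV[R]_d)) by exact: integrable_fct_cst.
have := oracle_step j c Y (fun=> 0) mY (rvec_measurable_cst _) i0.
rewrite /= Rintegral_cstT sqnorm0 add0r.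
by under eq_fun do rewrite add0r.
Qed.

(** The noise in [gt t.+1 i] is fresh and adds one [sigma^2]. The noise of [gt t i] is correlated
    with [ht t.+1 i], so it is split off by Young's inequality instead, at cost [6 / delta2]; the
    two make the constant 7. *)
Lemma gradient_shift_step t i :
  integrable_fct P (fun w => sqnorm (gt t i w - ht t i w)) ->
  integrable_fct P (fun w => sqnorm (xt t.+1 w - xt t w)) ->
  integrable_fct P (fun w => sqnorm (gt t.+1 i w - ht t.+1 i w)) /\
  \int[P]_w sqnorm (gt t.+1 i w - ht t.+1 i w) <=
    (1 - delta2 / 2) * \int[P]_w sqnorm (gt t i w - ht t i w)
    + 7 / delta2 * sigma ^+ 2
    + 6 / delta2 * (Li i ^+ 2 * \int[P]_w sqnorm (xt t.+1 w - xt t w)).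
Proof.
move=> ig ix; have /andP[d20 d21] := d2.
have [mx me mh mgt] := state_measurable_Omega t.
have [mx1 _ mh1 _] := state_measurable_Omega t.+1.
have [mx' _ mh' _] := state_measurable_zeta t.+1 (t.+2, i) (ltnSn _).
have [mxt _ _ _] := state_measurable_zeta t (t.+1, i) (ltnSn _).
have [ih hE] := shift_step t i ig.
pose u w := 1 *: (gt t i w - gfi i (xt t w)).
have [iu uE] : integrable_fct P (fun w => sqnorm (u w)) /\
    \int[P]_w sqnorm (u w) <= 1 ^+ 2 * sigma ^+ 2 := oracle_step0 (t.+1, i) 1 (xt t) mxt.
rewrite expr1n mul1r in uE.
pose V w := gfi i (xt t.+1 w) - ht t.+1 i w.
have mV : rvec_measurable V.
  by apply: rvec_measurableB => //; exact: lipschitz_rvec_measurable (Lgfi i) mx1.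
have [iV VE] : integrable_fct P (fun w => sqnorm (V w)) /\
    \int[P]_w sqnorm (V w) <= (1 + delta2 / 2) * \int[P]_w sqnorm (ht t.+1 i w - gt t i w)
    + (1 + (delta2 / 2)^-1) * 2 * \int[P]_w sqnorm (u w)
    + (1 + (delta2 / 2)^-1) * 2 * Li i ^+ 2 * \int[P]_w sqnorm (xt t.+1 w - xt t w).
  apply: integrable_fct_dom3 => //; first exact: measurable_sqnorm.
  move=> w; rewrite sqnorm_ge0/=.
  have d20' : 0 < delta2 / 2 by rewrite divr_gt0.
  (* Compression residual of the shift, old oracle noise, and change of the true gradient. Only the
     first keeps a factor near 1, which preserves the contraction. *)
  have -> : V w = - ((ht t.+1 i w - gt t i w) + (u w - (gfi i (xt t.+1 w) - gfi i (xt t w)))).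
    by rewrite /V /u scale1r; apply/rowP => k; rewrite !mxE; ring.
  rewrite sqnormN; apply: le_trans (sqnormD_young _ _ _ d20') _.
  have h2 := sqnormD2 (u w) (- (gfi i (xt t.+1 w) - gfi i (xt t w))).
  have h3 := Lgfi i (xt t.+1 w) (xt t w).
  rewrite sqnormN in h2.
  have h4 := le_trans h2 (lerD (lexx _) (ler_wpM2l (ler0n _ 2) h3)).
  have r0 : 0 <= 1 + (delta2 / 2)^-1 by rewrite addr_ge0// invr_ge0 ltW.
  have := ler_wpM2l r0 h4; lra.
have mV' : rvec_measurable (V : cyl (predC1 (t.+2, i)) predT predT -> _).
  by apply: rvec_measurableB => //; exact: lipschitz_rvec_measurable (Lgfi i) mx'.
have [iW WE] := oracle_step (t.+2, i) 1 (xt t.+1) V mx' mV' iV.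
have E w : sqnorm (gt t.+1 i w - ht t.+1 i w)
    = sqnorm (V w + 1 *: (g i (zeta t.+2 i w) (xt t.+1 w) - gfi i (xt t.+1 w))).
  congr sqnorm; rewrite /V scale1r -/(gt t.+1 i w).
  by apply/rowP => k; rewrite !mxE; ring.
under eq_fun do rewrite E.
split=> //; apply: le_trans WE _; rewrite expr1n mul1r.
have a0 : 0 <= \int[P]_w sqnorm (gt t i w - ht t i w).
  by apply: Rintegral_ge0 => // w _; exact: sqnorm_ge0.
have b0 : 0 <= \int[P]_w sqnorm (xt t.+1 w - xt t w).
  by apply: Rintegral_ge0 => // w _; exact: sqnorm_ge0.
move: VE hE uE; rewrite /= invf_div.
set A := \int[P]_w sqnorm (V w); set H := \int[P]_w sqnorm (ht t.+1 i w - _).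
set U := \int[P]_w sqnorm (u w); set B := \int[P]_w _ in b0 *.
set G := \int[P]_w _ in a0 *.
move=> VE hE uE.
set r := delta2^-1 in VE *.
have rd : r * delta2 = 1 by rewrite /r mulVf// gt_eqF.
have r1 : 1 <= r by rewrite /r invf_ge1.
have LB : 0 <= Li i ^+ 2 * B by rewrite mulr_ge0// sqr_ge0.
have s0 := sqr_ge0 sigma.
have h1 : (1 + delta2 / 2) * H <= (1 - delta2 / 2) * G.
  apply: (@le_trans _ _ ((1 + delta2 / 2) * ((1 - delta2) * G))).
    by rewrite ler_wpM2l// addr_ge0// divr_ge0// ltW.
  rewrite mulrA ler_wpM2r//; have := sqr_ge0 delta2; lra.
have h2 : (1 + 2 * r) * 2 * U <= 6 * r * sigma ^+ 2.
  apply: (@le_trans _ _ ((1 + 2 * r) * 2 * sigma ^+ 2)).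
    by rewrite ler_wpM2l//; lra.
  by rewrite ler_wpM2r//; lra.
have h3 : (1 + 2 * r) * 2 * Li i ^+ 2 * B <= 6 * r * (Li i ^+ 2 * B).
  by rewrite -[leLHS]mulrA ler_wpM2r//; lra.
have h4 : sigma ^+ 2 <= r * sigma ^+ 2 by rewrite ler_peMl.
rewrite -/r; lra.
Qed.

(** * Averages over the clients *)

Definition Et t := n%:R^-1 * \sum_(i < n) \int[P]_w sqnorm (et t i w).
Definition Gt t := n%:R^-1 * \sum_(i < n) \int[P]_w sqnorm (gt t i w - ht t i w).

Lemma Et_ge0 t : 0 <= Et t.
Proof.
rewrite mulr_ge0 ?invr_ge0 ?ler0n// sumr_ge0// => i _.
by apply: Rintegral_ge0 => // w _; exact: sqnorm_ge0.
Qed.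

Lemma Gt_ge0 t : 0 <= Gt t.
Proof.
rewrite mulr_ge0 ?invr_ge0 ?ler0n// sumr_ge0// => i _.
by apply: Rintegral_ge0 => // w _; exact: sqnorm_ge0.
Qed.

Lemma sqnorm_avg_et t : (forall i, integrable_fct P (fun w => sqnorm (et t i w))) ->
  integrable_fct P (fun w => sqnorm (avgv (fun i => et t i w))) /\
  \int[P]_w sqnorm (avgv (fun i => et t i w)) <= Et t.
Proof.
move=> ie; have [_ me _ _] := state_measurable_Omega t.
rewrite /Et -Rintegral_sumT// -RintegralZT; last exact: integrable_fct_sum.
apply: integrable_fct_dom; first exact/measurable_sqnorm/rvec_measurable_avgv.
  exact/integrable_fctZ/integrable_fct_sum.
by move=> w; rewrite sqnorm_ge0 sqnorm_avgv.
Qed.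

Lemma oracle_step_avg t (c : R) (V : Omega -> 'rV[R]_d) :
  (forall i, rvec_measurable (V : cyl (predC1 (t.+1, i)) predT predT -> _)) ->
  integrable_fct P (fun w => sqnorm (V w)) ->
  let W w := V w + c *: (avgv (fun i => gt t i w) - gradf (xt t w)) in
  integrable_fct P (fun w => sqnorm (W w)) /\
  \int[P]_w sqnorm (W w) <= \int[P]_w sqnorm (V w) + c ^+ 2 * (sigma ^+ 2 / n%:R).
Proof.
move=> mV iV W.
have nR : n%:R != 0 :> R by rewrite pnatr_eq0 -lt0n.
have E w : W w = V w + (c / n%:R) *: \sum_(i <- index_enum 'I_n) (gt t i w - gfi i (xt t w)).
  by rewrite /W /gradf -avgvN -avgvD /avgv scalerA.
under eq_fun do rewrite E.
have [iW WE] := oracle_step_sum t (c / n%:R) V _ (index_enum_uniq _) mV iV.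
split => //; apply: le_trans WE _; rewrite lerD2l.
rewrite -sum1_size sum1_card card_ord.
by rewrite le_eqVlt; apply/orP; left; apply/eqP; field.
Qed.

(** Three squares bound the displacement formula [xt_diff]; the averaged noise [sigma^2 / n] is
    relaxed to [sigma^2]. *)
Lemma displacement_bound t : (forall i, integrable_fct P (fun w => sqnorm (et t i w))) ->
  (forall i, integrable_fct P (fun w => sqnorm (et t.+1 i w))) ->
  integrable_fct P (fun w => sqnorm (gradf (xt t w))) ->
  integrable_fct P (fun w => sqnorm (xt t.+1 w - xt t w)) /\
  \int[P]_w sqnorm (xt t.+1 w - xt t w) <= 3 * gamma ^+ 2 *
    (Et t + Et t.+1 + (\int[P]_w sqnorm (gradf (xt t w)) + sigma ^+ 2)).
Proof.
move=> ie ie1 ig.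
have [i1 E1] := sqnorm_avg_et t ie; have [i2 E2] := sqnorm_avg_et t.+1 ie1.
have [mx _ _ mgt] := state_measurable_Omega t.
have [mx1 _ _ _] := state_measurable_Omega t.+1.
have mgr i : rvec_measurable ((fun w => gradf (xt t w)) :
    cyl (predC1 (t.+1, i)) predT predT -> _).
  have [mx' _ _ _] := state_measurable_zeta t (t.+1, i) (ltnSn _).
  by apply: rvec_measurable_avgv => k; exact: lipschitz_rvec_measurable (Lgfi k) mx'.
pose W w := gradf (xt t w) + 1 *: (avgv (fun i => gt t i w) - gradf (xt t w)).
have [i3 E3] : integrable_fct P (fun w => sqnorm (W w)) /\
    \int[P]_w sqnorm (W w) <= \int[P]_w sqnorm (gradf (xt t w))
      + 1 ^+ 2 * (sigma ^+ 2 / n%:R) := oracle_step_avg t 1 (fun w => gradf (xt t w)) mgr ig.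
have [iD DE] : integrable_fct P (fun w => sqnorm (xt t.+1 w - xt t w)) /\
    \int[P]_w sqnorm (xt t.+1 w - xt t w) <=
      3 * gamma ^+ 2 * \int[P]_w sqnorm (avgv (fun i => et t i w))
      + 3 * gamma ^+ 2 * \int[P]_w sqnorm (avgv (fun i => et t.+1 i w))
      + 3 * gamma ^+ 2 * \int[P]_w sqnorm (W w).
  apply: integrable_fct_dom3 => //; first exact/measurable_sqnorm/rvec_measurableB.
  move=> w; rewrite sqnorm_ge0/= xt_diff sqnormZ sqrrN.
  have -> : avgv (fun i => gt t i w) = W w by rewrite /W scale1r addrC subrK.
  have := sqnormD3 (avgv (fun i => et t i w)) (- avgv (fun i => et t.+1 i w)) (W w).
  rewrite sqnormN => h; apply: le_trans (ler_wpM2l (sqr_ge0 gamma) h) _.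
  by rewrite le_eqVlt; apply/orP; left; apply/eqP; ring.
split=> //; apply: le_trans DE _; rewrite expr1n mul1r in E3.
have h : sigma ^+ 2 / n%:R <= sigma ^+ 2.
  by rewrite ler_piMr ?sqr_ge0// invf_le1 ?ltr0n// ler1n.
have E4 := le_trans E3 (lerD (lexx _) h).
have c0 : 0 <= 3 * gamma ^+ 2 by rewrite mulr_ge0 ?sqr_ge0.
have := lerD (lerD (ler_wpM2l c0 E1) (ler_wpM2l c0 E2)) (ler_wpM2l c0 E4).
by rewrite -!mulrDr.
Qed.

(** The initial shift and the first gradient are two independent calls at [x0], with seeds of index
    0 and 1; each contributes [sigma^2]. *)
Lemma gradient_shift_init i : integrable_fct P (fun w => sqnorm (gt 0 i w - ht 0 i w)) /\
  \int[P]_w sqnorm (gt 0 i w - ht 0 i w) <= 2 * sigma ^+ 2.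
Proof.
pose V w := -1 *: (ht 0 i w - gfi i x0).
have [iV VE] : integrable_fct P (fun w => sqnorm (V w)) /\
    \int[P]_w sqnorm (V w) <= (-1) ^+ 2 * sigma ^+ 2 :=
  oracle_step0 (0, i)%N (-1) (fun=> x0) (rvec_measurable_cst _).
have [mx' _ mh' _] := state_measurable_zeta 0 (1, i)%N (ltnSn _).
have mV : rvec_measurable (V : cyl (predC1 (1, i)%N) predT predT -> _).
  apply/rvec_measurableZ/rvec_measurableB; first exact: (mh' i).
  exact: rvec_measurable_cst.
have [iW WE] := oracle_step (1, i)%N 1 (xt 0) V mx' mV iV.
have E w : sqnorm (gt 0 i w - ht 0 i w)
    = sqnorm (V w + 1 *: (g i (zeta 1 i w) (xt 0 w) - gfi i (xt 0 w))).
  by congr sqnorm; rewrite /V /gt /ht /xt /=; apply/rowP => k; rewrite !mxE; ring.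
under eq_fun do rewrite E.
split=> //; apply: le_trans WE _; move: VE; rewrite sqrrN expr1n !mul1r; lra.
Qed.


(** * Descent of the virtual iterate and the coupled recursions *)

Variables (f : 'rV[R]_d -> R) (xs : 'rV[R]_d) (mu l : R).
Hypothesis cf : continuous f.
Hypothesis f_ge : forall x, f xs <= f x.
Hypothesis gradf_le : forall x, sqnorm (gradf x) <= 4 * l * (f x - f xs).
Hypothesis sqc : strongly_quasi_convex f gradf mu xs.
Hypothesis mu0 : 0 < mu.
Hypothesis l0 : 0 < l.
Hypothesis mu_le_2l : mu <= 2 * l.
Hypothesis gamma0 : 0 < gamma.
Hypothesis gl16 : 16 * (gamma * l) <= 1.

Definition Xt t := \int[P]_w sqnorm (virt t w - xs).
Definition Ft t := \int[P]_w (f (xt t w) - f xs).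

Lemma virt_measurable {dT} {T : measurableType dT} t (toO : T -> Omega) :
  rvec_measurable (fun w => xt t (toO w)) ->
  (forall i, rvec_measurable (fun w => et t i (toO w))) ->
  rvec_measurable (fun w => virt t (toO w)).
Proof.
move=> mx me; apply: (rvec_measurableB _ (fun w => gamma *: avgv (fun i => et t i (toO w)))) => //.
by apply: rvec_measurableZ; exact: (rvec_measurable_avgv _ (fun i w => et t i (toO w)) me).
Qed.

Lemma gradf_measurable {dT} {T : measurableType dT} (Y : T -> 'rV[R]_d) :
  rvec_measurable Y -> rvec_measurable (fun w => gradf (Y w)).
Proof.
by move=> mY; apply: rvec_measurable_avgv => k; exact: lipschitz_rvec_measurable (Lgfi k) mY.
Qed.

Lemma virtual_step t : integrable_fct P (fun w => sqnorm (virt t w - xs)) ->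
  (forall i, integrable_fct P (fun w => sqnorm (et t i w))) ->
  [/\ integrable_fct P (fun w => f (xt t w) - f xs),
      integrable_fct P (fun w => sqnorm (gradf (xt t w))),
      \int[P]_w sqnorm (gradf (xt t w)) <= 4 * l * Ft t,
      integrable_fct P (fun w => sqnorm (virt t.+1 w - xs))
    & Xt t.+1 + gamma * Ft t <= (1 - gamma * mu / 2) * Xt t
        + 10 * l * gamma ^+ 3 * Et t + gamma ^+ 2 * (sigma ^+ 2 / n%:R)].
Proof.
move=> iX ie.
have [mx me mh mgt] := state_measurable_Omega t.
have [ia aE] := sqnorm_avg_et t ie.
have mvirt : rvec_measurable (virt t) by exact: (virt_measurable t id).
(* The virtual step with the true gradient, which depends on none of the oracle seeds of index
   [t.+1]; the remaining noise is added afterwards by [oracle_step_avg]. *)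
pose V w := virt t w - xs - gamma *: gradf (xt t w).
have mV : rvec_measurable V.
  apply: rvec_measurableB; last by apply: rvec_measurableZ; exact: gradf_measurable.
  by apply: rvec_measurableB => //; exact: rvec_measurable_cst.
have mF : measurable_fun setT (fun w => f (xt t w) - f xs).
  by apply: measurable_funB; [exact: measurable_continuous_comp|exact: measurable_cst].
have F0 w : 0 <= f (xt t w) - f xs by rewrite subr_ge0.
have VF w : sqnorm (V w) + gamma * (f (xt t w) - f xs)
    <= (1 - gamma * mu / 2) * sqnorm (virt t w - xs)
       + 10 * l * gamma ^+ 3 * sqnorm (avgv (fun i => et t i w)).
  exact: virtual_gradient_step.
(* The sum is dominated by integrable quantities, and its summands are nonnegative, so integrability
   of the function gap comes out of the descent inequality itself. *)
have [iS SE] : integrable_fct P (fun w => sqnorm (V w) + gamma * (f (xt t w) - f xs)) /\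
    \int[P]_w (sqnorm (V w) + gamma * (f (xt t w) - f xs))
    <= (1 - gamma * mu / 2) * Xt t
       + 10 * l * gamma ^+ 3 * \int[P]_w sqnorm (avgv (fun i => et t i w)).
  apply: integrable_fct_dom2 => //.
    apply: measurable_funD; first exact: measurable_sqnorm.
    by apply: measurable_funM.
  by move=> w; rewrite VF andbT addr_ge0 ?sqnorm_ge0// mulr_ge0// ltW.
have iV : integrable_fct P (fun w => sqnorm (V w)).
  apply: proj1 (integrable_fct_dom P _ _ _ iS _); first exact: measurable_sqnorm.
  by move=> w; rewrite sqnorm_ge0 lerDl mulr_ge0// ltW.
have iF : integrable_fct P (fun w => f (xt t w) - f xs).
  apply: proj1 (integrable_fct_dom P _ _ _ (integrable_fctZ P gamma^-1 _ iS) _) => // w.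
  rewrite F0/= mulrDr mulKf ?gt_eqF// lerDr mulr_ge0 ?sqnorm_ge0//.
  by rewrite invr_ge0 ltW.
have [iG GE] : integrable_fct P (fun w => sqnorm (gradf (xt t w))) /\
    \int[P]_w sqnorm (gradf (xt t w)) <= \int[P]_w (4 * l * (f (xt t w) - f xs)).
  apply: integrable_fct_dom; first exact/measurable_sqnorm/gradf_measurable.
    exact: integrable_fctZ.
  by move=> w; rewrite sqnorm_ge0 gradf_le.
rewrite RintegralZT// in GE.
have mV' i : rvec_measurable (V : cyl (predC1 (t.+1, i)) predT predT -> _).
  have [mx' me' _ _] := state_measurable_zeta t (t.+1, i) (ltnSn _).
  apply: rvec_measurableB; last by apply: rvec_measurableZ; exact: gradf_measurable.
  by apply: rvec_measurableB; [exact: virt_measurable|exact: rvec_measurable_cst].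
have [iW WE] := oracle_step_avg t (- gamma) V mV' iV.
have E w : sqnorm (virt t.+1 w - xs) = sqnorm (V w + - gamma *:
    (avgv (fun i => gt t i w) - gradf (xt t w))).
  congr sqnorm; rewrite virt_succ /V; move: (virt t w) (gradf _) (avgv _) => z a b.
  by apply/rowP => k; rewrite !mxE; ring.
have EX : Xt t.+1 = \int[P]_w sqnorm (V w + - gamma *:
    (avgv (fun i => gt t i w) - gradf (xt t w))).
  by apply: eq_Rintegral => w _; exact: E.
split => //; first by under eq_fun do rewrite E.
rewrite EX.
rewrite (RintegralDT P _ _ iV (integrable_fctZ P gamma _ iF)) RintegralZT// -/(Ft t) in SE.
rewrite sqrrN in WE.
have c0 : 0 <= 10 * l * gamma ^+ 3 by rewrite !mulr_ge0// ?exprn_ge0// ltW.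
apply: le_trans (lerD WE (lexx (gamma * Ft t))) _.
rewrite addrAC lerD2r; apply: le_trans SE _.
by rewrite lerD2l ler_wpM2l.
Qed.

(** The invariant of the induction over time: one step from an integrable state yields finite
    expectations again. *)
Definition integrable_state t :=
  [/\ integrable_fct P (fun w => sqnorm (virt t w - xs)),
      forall i, integrable_fct P (fun w => sqnorm (et t i w))
    & forall i, integrable_fct P (fun w => sqnorm (gt t i w - ht t i w))].

Lemma integrable_state0 : integrable_state 0.
Proof.
split=> [|i|i]; last by have [] := gradient_shift_init i.
  under eq_fun do rewrite /virt /xt /et/= avgv0 scaler0 subr0.
  exact: (integrable_fct_cst P (sqnorm (x0 - xs))).
exact: (integrable_fct_cst P (sqnorm 0)).
Qed.

Lemma one_step t : integrable_state t ->
  [/\ integrable_state t.+1, integrable_fct P (fun w => f (xt t w) - f xs),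
      Xt t.+1 + gamma * Ft t <= (1 - gamma * mu / 2) * Xt t
        + 10 * l * gamma ^+ 3 * Et t + gamma ^+ 2 * (sigma ^+ 2 / n%:R),
      Et t.+1 <= (1 - delta1 / 2) * Et t + 2 / delta1 * Gt t
    & Gt t.+1 <= (1 - delta2 / 2) * Gt t + 7 / delta2 * sigma ^+ 2
        + 6 / delta2 * (mean_sqr_Li * (3 * gamma ^+ 2 *
            (Et t + Et t.+1 + (4 * l * Ft t + sigma ^+ 2))))].
Proof.
move=> [iX ie ig].
have nR : n%:R != 0 :> R by rewrite pnatr_eq0 -lt0n.
have nV : 0 <= n%:R^-1 :> R by rewrite invr_ge0 ler0n.
have [iF iG GE iX1 XE] := virtual_step t iX ie.
have ie1 i := (error_step t i (ie i) (ig i)).1.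
have [iD DE] := displacement_bound t ie ie1 iG.
split=> //.
- by split=> // i; have [] := gradient_shift_step t i (ig i) iD.
- rewrite /Et /Gt [(1 - _) * _]mulrCA [2 / _ * _]mulrCA -mulrDr ler_wpM2l//.
  rewrite !mulr_sumr -big_split; apply: ler_sum => i _.
  by have [] := error_step t i (ie i) (ig i).
- set D := \int[P]_w _ in DE.
  apply: (@le_trans _ _ ((1 - delta2 / 2) * Gt t + 7 / delta2 * sigma ^+ 2
      + 6 / delta2 * (mean_sqr_Li * D))).
    (* The displacement [D] is common to all clients, so averaging the individual bounds turns the
       constants [Li i ^+ 2] into their mean. *)
    have -> : (1 - delta2 / 2) * Gt t + 7 / delta2 * sigma ^+ 2 + 6 / delta2 * (mean_sqr_Li * D)
      = n%:R^-1 * \sum_(i < n) ((1 - delta2 / 2) * \int[P]_w sqnorm (gt t i w - ht t i w)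
        + 7 / delta2 * sigma ^+ 2 + 6 / delta2 * (Li i ^+ 2 * D)).
      rewrite !big_split /= sumr_const card_ord -(mulr_natl (7 / delta2 * sigma ^+ 2)).
      rewrite -!mulr_sumr -mulr_suml /Gt /mean_sqr_Li.
      move: (\sum_(i < n) _) (\sum_(i < n) _) => S1 S2; field.
      by rewrite nR gt_eqF//; case/andP: d2.
    rewrite ler_wpM2l//; apply: ler_sum => i _.
    by have [] := gradient_shift_step t i (ig i) iD.
  rewrite lerD2l; apply: ler_wpM2l; first by rewrite divr_ge0// ltW//; case/andP: d2.
  apply: ler_wpM2l; first exact: mean_sqr_Li_ge0.
  apply: le_trans DE _; apply: ler_wpM2l; first by rewrite mulr_ge0 ?sqr_ge0.
  by rewrite lerD2l lerD2r.
Qed.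

Lemma integrable_state_all t : integrable_state t.
Proof. by elim: t => [|t IH]; [exact: integrable_state0|have [] := one_step t IH]. Qed.

Lemma Xt0 : Xt 0 = sqnorm (x0 - xs).
Proof.
rewrite /Xt; under eq_fun do rewrite /virt /xt /et/= avgv0 scaler0 subr0.
exact: Rintegral_cstT.
Qed.

Lemma Et0 : Et 0 = 0.
Proof.
rewrite /Et big1 ?mulr0// => i _.
by under eq_fun do rewrite /et /= sqnorm0; exact: Rintegral_cstT.
Qed.

Lemma Gt0 : Gt 0 <= 2 * sigma ^+ 2.
Proof.
have nR : n%:R != 0 :> R by rewrite pnatr_eq0 -lt0n.
have nV : 0 <= n%:R^-1 :> R by rewrite invr_ge0 ler0n.
have -> : 2 * sigma ^+ 2 = n%:R^-1 * \sum_(i < n) 2 * sigma ^+ 2.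
  by rewrite sumr_const card_ord -(mulr_natl (2 * sigma ^+ 2)) mulKf.
by rewrite ler_wpM2l//; apply: ler_sum => i _; have [] := gradient_shift_init i.
Qed.

Lemma Xt_ge0 t : 0 <= Xt t.
Proof. by apply: Rintegral_ge0 => w _; exact: sqnorm_ge0. Qed.

Lemma Ft_ge0 t : 0 <= Ft t.
Proof. by apply: Rintegral_ge0 => w _; rewrite subr_ge0. Qed.


Lemma integrable_gap t : integrable_fct P (fun w => f (xt t w) - f xs).
Proof. by have [] := one_step t (integrable_state_all t). Qed.

Hypothesis gl512 : 512 * (gamma * l) <= delta1 * delta2.
Hypothesis gL512 : 512 ^+ 2 * (gamma ^+ 2 * mean_sqr_Li) <= (delta1 * delta2) ^+ 2.

(** The Lyapunov recursion is summed with weights and its nonnegative final value dropped. Initially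
    the errors vanish, so only the starting distance and the [2 sigma^2] of [Gt 0] remain. *)
Lemma weighted_gap_bound T (rho := 1 - gamma * mu / 2) : 0 < rho ->
  gamma / 2 * \sum_(t < T.+1) rho ^- t.+1 * Ft t <=
    sqnorm (x0 - xs) + 1280 * l * gamma ^+ 3 / (delta1 ^+ 2 * delta2) * (2 * sigma ^+ 2)
    + (gamma ^+ 2 * (sigma ^+ 2 / n%:R)
       + 10240 * l * gamma ^+ 3 / (delta1 * delta2) ^+ 2 * sigma ^+ 2)
      * \sum_(t < T.+1) rho ^- t.+1.
Proof.
move=> rho0.
set a := 80 * l * gamma ^+ 3 / delta1.
set b := 1280 * l * gamma ^+ 3 / (delta1 ^+ 2 * delta2).
have [/andP[d10 _] /andP[d20 _]] := (d1, d2).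
have lg0 : 0 < l * gamma ^+ 3 by rewrite mulr_gt0// exprn_gt0.
have a0 : 0 <= a by rewrite /a -[80 * _ * _]mulrA divr_ge0 ?mulr_ge0// ltW.
have b0 : 0 <= b.
  rewrite /b -[1280 * _ * _]mulrA; apply: divr_ge0; last by rewrite mulr_ge0 ?exprn_ge0// ltW.
  by apply: mulr_ge0; [exact: ler0n|exact: ltW].
have rec t : Xt t.+1 + a * Et t.+1 + b * Gt t.+1 + gamma / 2 * Ft t
    <= rho * (Xt t + a * Et t + b * Gt t) + (gamma ^+ 2 * (sigma ^+ 2 / n%:R)
       + 10240 * l * gamma ^+ 3 / (delta1 * delta2) ^+ 2 * sigma ^+ 2).
  have [_ _ HX HE HG] := one_step t (integrable_state_all t).
  exact: (lyapunov_step _ _ _ _ _ _ _ _ _ _ _ _ _ _ _ _ _ d1 d2 gamma0 l0 mu0 mu_le_2l gl512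
    gL512 mean_sqr_Li_ge0 (sqr_ge0 sigma) (Et_ge0 t) (Et_ge0 t.+1) (Gt_ge0 t)
    (Ft_ge0 t) HX HE HG).
have := weighted_sum_recursion rho _ _ (fun t => Xt t + a * Et t + b * Gt t) Ft rho0 rec T.
rewrite Xt0 Et0 mulr0 addr0 => h.
apply: le_trans (le_trans _ h) _.
  rewrite lerDr mulr_ge0//; first by rewrite invr_ge0 exprn_ge0// ltW.
  apply: addr_ge0; last exact: mulr_ge0 b0 (Gt_ge0 _).
  exact: addr_ge0 (Xt_ge0 _) (mulr_ge0 a0 (Et_ge0 _)).
by rewrite lerD2r lerD2l ler_wpM2l// Gt0.
Qed.

End Process.

(** * Stepsize and complexity *)

Lemma is_gradient_avgf {R : realType} {n d : nat} (fi : 'I_n -> 'rV[R]_d -> R)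
    (gfi : 'I_n -> 'rV[R]_d -> 'rV[R]_d) :
  (forall i, is_gradient (fi i) (gfi i)) ->
  is_gradient (avgf fi) (fun x => avgv (fun i => gfi i x)).
Proof.
move=> H x.
have sumP (s : seq 'I_n) : differentiable (fun y => \sum_(i <- s) fi i y) x /\
    forall v, 'd (fun y => \sum_(i <- s) fi i y) x v = dotv (\sum_(i <- s) gfi i x) v.
  elim: s => [|i s [ds dE]].
    under eq_fun do rewrite big_nil; rewrite big_nil.
    split=> [|v]; first exact: differentiable_cst.
    by rewrite diff_cst -[X in dotv X _](scale0r 0) dotvZl mul0r.
  have [di iE] := H i x.
  have -> : (fun y => \sum_(j <- i :: s) fi j y) = fi i + (fun y => \sum_(j <- s) fi j y).
    by apply/funext => y; rewrite big_cons.
  split=> [|v]; first exact: differentiableD.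
  by rewrite diffD//= iE dE big_cons dotvDl.
have [ds dE] := sumP (index_enum 'I_n).
have -> : avgf fi = n%:R^-1 *: (fun y => \sum_(i < n) fi i y) by [].
split=> [|v]; first exact: differentiableZ.
by rewrite diffZ//= dE dotvZl.
Qed.

Lemma lipschitz_const_ge0 {R : realType} {d : nat} (gf : 'rV[R]_d -> 'rV[R]_d) (L : R) :
  (0 < d)%N -> lipschitz_grad gf L -> 0 <= L.
Proof.
case: d gf => // d gf _ H; pose b : 'rV[R]_d.+1 := const_mx 1.
have b0 : 0 < sqnorm b.
  by apply: lt_le_trans (sqr_coord_le b ord0); rewrite mxE expr1n.
have := H b 0; rewrite subr0 => h.
have : 0 <= L * norm2 b by apply: le_trans h; exact: sqrtr_ge0.
by rewrite pmulr_lge0// sqrtr_gt0.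
Qed.

(** The gradient vanishes at the minimizer. At [xs + b] quasi-convexity gives
    [mu/2 |b|^2 <= <gf(xs + b), b>], while the Lipschitz bound gives [|gf(xs + b)| <= l |b|]. *)
Lemma quasi_convex_modulus_le {R : realType} {d : nat} (f : 'rV[R]_d -> R)
    (gf : 'rV[R]_d -> 'rV[R]_d) (xs : 'rV[R]_d) (mu l : R) :
  (0 < d)%N -> is_gradient f gf ->
  (forall x y, sqnorm (gf x - gf y) <= l ^+ 2 * sqnorm (x - y)) ->
  (forall x, f xs <= f x) -> strongly_quasi_convex f gf mu xs -> 0 < mu -> 0 <= l ->
  mu <= 2 * l.
Proof.
case: d f gf xs => // d f gf xs _ fgf lip fmin sqc mu0 l0.
have gxs : sqnorm (gf xs) <= 0.
  (* The gradient bound asks for a positive constant, and [l] is only known to be nonnegative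
     here. *)
  have lip' x y : sqnorm (gf x - gf y) <= (l + 1) ^+ 2 * sqnorm (x - y).
    apply: le_trans (lip x y) _; rewrite ler_wpM2r ?sqnorm_ge0//.
    by rewrite ler_pXn2r ?nnegrE ?addr_ge0// lerDl.
  have := sqnorm_gradient_le f gf fgf (l + 1) (f xs) lip' fmin xs.
  by rewrite subrr mulr0; apply; rewrite ltr_wpDl.
have gxs0 : gf xs = 0.
  apply/rowP => k; rewrite mxE; apply/eqP; rewrite -sqrf_eq0 eq_le sqr_ge0 andbT.
  exact: le_trans (sqr_coord_le _ _) gxs.
pose b : 'rV[R]_d.+1 := const_mx 1.
have b0 : 0 < sqnorm b.
  by apply: lt_le_trans (sqr_coord_le b ord0); rewrite mxE expr1n.
have h1 := lip (xs + b) xs; rewrite gxs0 subr0 addrAC subrr add0r in h1.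
have h2 := sqc (xs + b); rewrite opprD addrA subrr add0r sqnormN dotvNr in h2.
have h3 := fmin (xs + b).
(* Expanding this square takes the place of the Cauchy-Schwarz inequality. *)
have h4 := sqnorm_ge0 (gf (xs + b) - (mu / 2) *: b).
rewrite sqnormD sqnormN sqnormZ dotvNr dotvZr in h4.
move: h1 h2 h4; set G := sqnorm (gf _); set B := sqnorm b in b0 *.
set D := dotv _ _ => h1 h2 h4.
have h5 : mu * (mu / 2 * B) <= mu * D by rewrite ler_pM2l//; clear - h2 h3; lra.
have h6 : (mu / 2) ^+ 2 * B <= l ^+ 2 * B by clear - h1 h4 h5; lra.
have m0 : 0 <= mu / 2 by rewrite divr_ge0// ltW.
have h : mu / 2 <= l by move: h6; rewrite ler_pM2r// ler_pXn2r ?nnegrE.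
by clear - h; lra.
Qed.

(** This is [1 - x <= exp(-x)], inverted and raised to the power [m]. *)
Lemma inv_pow_ge_expR {R : realType} (x : R) (m : nat) : 0 < 1 - x ->
  expR (x * m%:R) <= (1 - x) ^- m.
Proof.
move=> x0; rewrite mulrC expRM_natl -exprVn lerXn2r ?nnegrE ?expR_ge0 ?invr_ge0 ?(ltW x0)//.
rewrite -[leLHS]invrK -expRN lef_pV2 ?posrE ?expR_gt0//.
by have := expR_ge1Dx (- x).
Qed.

(** * Consequences of the choice of the stepsize *)

Section Stepsize.
Context {R : realType}.
Variables (L Lt mu sigma p q eps n S D A : R).
Hypothesis n1 : 1 <= n.
Hypothesis mu0 : 0 < mu.
Hypothesis p01 : 0 < p <= 1.
Hypothesis q01 : 0 < q <= 1.
Hypothesis eps0 : 0 < eps.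
Hypothesis sigma0 : 0 <= sigma.
Hypothesis L0 : 0 < L.
Hypothesis Lt0 : 0 < Lt.
Hypothesis S0 : 0 <= S.
Hypothesis D2 : 2 <= D.
Hypotheses (hsigma : sigma <= D) (hL : L <= D) (hLt : Lt <= D) (hp : p^-1 <= D)
  (hq : q^-1 <= D) (heps : eps^-1 <= D) (hS : S <= D).
Hypothesis AE : A = sigma ^+ 2 / (mu * n * eps)
  + Num.sqrt L * sigma / (mu * p * q * Num.sqrt eps) + Lt / (mu * p * q).

Let p0 : 0 < p. Proof. by case/andP: p01. Qed.
Let q0 : 0 < q. Proof. by case/andP: q01. Qed.
Let n0 : 0 < n. Proof. exact: lt_le_trans n1. Qed.
Let se0 : 0 < Num.sqrt eps. Proof. by rewrite sqrtr_gt0. Qed.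
Let sL0 : 0 <= Num.sqrt L. Proof. exact: sqrtr_ge0. Qed.

Lemma muAE : mu * A = sigma ^+ 2 / (n * eps)
  + Num.sqrt L * sigma / (p * q * Num.sqrt eps) + Lt / (p * q).
Proof. by rewrite AE; field; rewrite !gt_eqF. Qed.

Let muA_term1_ge0 : 0 <= sigma ^+ 2 / (n * eps).
Proof. by rewrite divr_ge0 ?sqr_ge0// mulr_ge0// ltW. Qed.
Let muA_term2_ge0 : 0 <= Num.sqrt L * sigma / (p * q * Num.sqrt eps).
Proof. by rewrite divr_ge0 ?mulr_ge0// ltW. Qed.
Let muA_term3_gt0 : 0 < Lt / (p * q).
Proof. by rewrite divr_gt0 ?mulr_gt0. Qed.

Lemma muA_gt0 : 0 < mu * A. Proof. by rewrite muAE ltr_wpDl// addr_ge0. Qed.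
Lemma A_gt0 : 0 < A. Proof. by have := muA_gt0; rewrite pmulr_rgt0. Qed.

Let gamma := (512 * (mu * A))^-1.

Let c0 : 0 < 512 * (mu * A).
Proof. by apply: mulr_gt0; [rewrite ltr0n|exact: muA_gt0]. Qed.

Lemma gamma_gt0 : 0 < gamma. Proof. by rewrite invr_gt0. Qed.

(** Each of the three summands of [mu * A] qualifies as [x]; they yield the three conditions
    [gamma_sigma], [gamma_sigmaL] (after squaring) and [gamma_Lt]. *)
Let gammaK x : x <= mu * A -> 512 * gamma * x <= 1.
Proof.
move=> h; have gk : 512 * gamma * (mu * A) = 1.
  by rewrite mulrAC; apply: divff; exact: lt0r_neq0.
rewrite -[leRHS]gk; apply: (ler_wpM2l _ h).
by apply: mulr_ge0; [exact: ler0n|exact: ltW gamma_gt0].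
Qed.

Lemma gamma_Lt : 512 * (gamma * Lt) <= p * q.
Proof.
have h : 512 * gamma * (Lt / (p * q)) <= 1.
  by apply: gammaK; rewrite muAE lerDr addr_ge0.
have pq0 : 0 < p * q by rewrite mulr_gt0.
by rewrite mulrA ler_pdivrMr// mul1r in h; rewrite mulrA.
Qed.

Lemma gamma_sigma : 512 * (gamma * (sigma ^+ 2 / n)) <= eps.
Proof.
have h : 512 * gamma * (sigma ^+ 2 / (n * eps)) <= 1.
  by apply: gammaK; rewrite muAE -addrA lerDl addr_ge0// ltW.
by rewrite invfM [sigma ^+ 2 * _]mulrA mulrA ler_pdivrMr// mul1r in h; rewrite mulrA.
Qed.

Lemma gamma_sigmaL : 512 ^+ 2 * (gamma ^+ 2 * L * sigma ^+ 2) <= (p * q) ^+ 2 * eps.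
Proof.
have h : 512 * gamma * (Num.sqrt L * sigma / (p * q * Num.sqrt eps)) <= 1.
  by apply: gammaK; rewrite muAE addrAC lerDr addr_ge0// ltW.
have pqe0 : 0 < p * q * Num.sqrt eps by rewrite !mulr_gt0.
rewrite mulrA ler_pdivrMr// mul1r in h.
have h0 : 0 <= 512 * gamma * (Num.sqrt L * sigma).
  by apply: mulr_ge0; [apply: mulr_ge0; [exact: ler0n|exact: ltW gamma_gt0]|exact: mulr_ge0].
have := ler_pM h0 h0 h h.
have e1 : 512 * gamma * (Num.sqrt L * sigma) * (512 * gamma * (Num.sqrt L * sigma))
    = 512 ^+ 2 * (gamma ^+ 2 * Num.sqrt L ^+ 2 * sigma ^+ 2) by ring.
have e2 : p * q * Num.sqrt eps * (p * q * Num.sqrt eps) = (p * q) ^+ 2 * Num.sqrt eps ^+ 2.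
  by ring.
by rewrite e1 e2 !sqr_sqrtr// ltW.
Qed.

(** Follows from [gamma_Lt], since [64 sqrt 2 <= 128 <= 512]. *)
Lemma gamma_cap : gamma <= p * q / (64 * Num.sqrt 2 * Lt).
Proof.
have s2 : Num.sqrt 2 <= 2 :> R.
  have h : Num.sqrt 2 <= Num.sqrt (2 ^+ 2) :> R by rewrite ler_wsqrtr// expr2; lra.
  by rewrite sqrtr_sqr ger0_norm in h.
have s20 : 0 < Num.sqrt 2 :> R by rewrite sqrtr_gt0 ltr0n.
rewrite ler_pdivlMr; last by apply: mulr_gt0 => //; apply: mulr_gt0 => //; rewrite ltr0n.
apply: le_trans gamma_Lt.
have h : gamma * Lt * Num.sqrt 2 <= gamma * Lt * 2.
  by apply: ler_wpM2l => //; apply: mulr_ge0; apply: ltW => //; exact: gamma_gt0.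
have gL : 0 <= gamma * Lt by apply: mulr_ge0; apply: ltW => //; exact: gamma_gt0.
have -> : gamma * (64 * Num.sqrt 2 * Lt) = 64 * (gamma * Lt * Num.sqrt 2) by ring.
apply: le_trans (_ : 64 * (gamma * Lt * 2) <= _).
  by apply: ler_wpM2l => //; rewrite ler0n.
rewrite mulrCA -natrM mulrC; apply: ler_wpM2r => //.
by rewrite ler_nat.
Qed.

(** The middle summand is a product of five factors, each at most [D]; the other two have a bound
    [D^3]. *)
Lemma muA_le : mu * A <= 3 * D ^+ 5.
Proof.
have D0 : 0 <= D by apply: le_trans D2; rewrite ler0n.
have D1 : 1 <= D by apply: le_trans D2; rewrite ler1n.
have sq_le x : x <= D -> Num.sqrt x <= D.
  move=> xD; apply: (@le_trans _ _ (Num.sqrt (D ^+ 2))); last by rewrite sqrtr_sqr ger0_norm.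
  by rewrite ler_wsqrtr//; apply: le_trans xD _; rewrite expr2 ler_peMl.
have mono k : (k <= 5)%N -> D ^+ k <= D ^+ 5 by move=> k5; exact: ler_weXn2l.
have nV : n^-1 <= 1 by rewrite invf_le1.
have pV0 : 0 <= p^-1 by rewrite invr_ge0 ltW.
have qV0 : 0 <= q^-1 by rewrite invr_ge0 ltW.
have pq : p^-1 * q^-1 <= D * D by apply: ler_pM.
have u1 : sigma ^+ 2 / (n * eps) <= D ^+ 5.
  apply: le_trans (mono 3%N isT); rewrite invfM.
  have -> : D ^+ 3 = D ^+ 2 * (1 * D) by ring.
  apply: ler_pM; rewrite ?sqr_ge0 ?mulr_ge0 ?invr_ge0 ?(ltW n0) ?(ltW eps0)//.
    by rewrite ler_pXn2r ?nnegrE.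
  by apply: ler_pM; rewrite ?invr_ge0 ?(ltW n0) ?(ltW eps0).
have u2 : Num.sqrt L * sigma / (p * q * Num.sqrt eps) <= D ^+ 5.
  rewrite !invfM -sqrtrV; last exact: ltW.
  have -> : D ^+ 5 = D * D * (D * D * D) by ring.
  have se : Num.sqrt eps^-1 <= D by exact: sq_le.
  by apply: ler_pM; rewrite ?mulr_ge0 ?sqrtr_ge0//; apply: ler_pM;
    rewrite ?mulr_ge0 ?sqrtr_ge0// sq_le.
have u3 : Lt / (p * q) <= D ^+ 5.
  apply: le_trans (mono 3%N isT); rewrite invfM.
  have -> : D ^+ 3 = D * (D * D) by ring.
  by apply: ler_pM; rewrite ?mulr_ge0// ltW.
have -> : 3 * D ^+ 5 = D ^+ 5 + D ^+ 5 + D ^+ 5 by ring.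
by rewrite muAE; apply: lerD => //; exact: lerD.
Qed.

(** Here [eps^-1 * (mu A) * S <= 3 D^7 <= 2^2 D^7], and powers of 2 are below powers of [D]; the
    exponent is [20 = 11 + 2 + 7]. *)
Lemma init_term_le W : D ^+ 20 <= W -> 2 ^+ 11 * (mu * A) * S <= eps * W.
Proof.
move=> hW.
have D0 : 0 < D by apply: lt_le_trans D2; rewrite ltr0n.
rewrite -ler_pdivrMl//; apply: le_trans hW.
have h1 : mu * A * S <= 3 * D ^+ 5 * D.
  by apply: ler_pM; rewrite ?(ltW muA_gt0)// muA_le.
have h2 : eps^-1 * (mu * A * S) <= D * (3 * D ^+ 5 * D).
  by apply: ler_pM; rewrite ?invr_ge0 ?(ltW eps0)// mulr_ge0// ltW// muA_gt0.
have e : eps^-1 * (2 ^+ 11 * (mu * A) * S) = 2 ^+ 11 * (eps^-1 * (mu * A * S)).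
  by move: (mu * A) => x; move: (2 ^+ 11) => y; ring.
rewrite e; apply: (@le_trans _ _ (2 ^+ 11 * (D * (3 * D ^+ 5 * D)))).
  by rewrite ler_pM2l// exprn_gt0// ltr0n.
have -> : D * (3 * D ^+ 5 * D) = 3 * D ^+ 7 by ring.
have h3 : 3 * D ^+ 7 <= 2 ^+ 2 * D ^+ 7.
  by rewrite ler_wpM2r ?exprn_ge0 ?(ltW D0)// -natrX ler_nat.
apply: (@le_trans _ _ (2 ^+ 11 * (2 ^+ 2 * D ^+ 7))).
  by rewrite ler_pM2l// exprn_gt0// ltr0n.
rewrite mulrA -exprD -[20%N]/(11 + 2 + 7)%N [in leRHS]exprD.
by rewrite ler_pM2r ?exprn_gt0//; apply: lerXn2r; rewrite ?nnegrE// ltW.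
Qed.

End Stepsize.

(** After division by [gamma / 2] the initial term takes half of [eps W], the averaged noise [2/512]
    of it, and the compression noise [(5120 + 20480)/512^2]; the total is below 1. *)
Lemma weighted_gap_le_eps {R : realFieldType} (gamma B l L p q eps v s2 S W Sig : R) :
  0 < gamma -> gamma = (512 * B)^-1 -> 0 < B -> 0 < p -> 0 < q -> q <= 1 ->
  0 < eps -> 0 < l -> l <= L -> 0 <= s2 -> 1 <= W ->
  gamma / 2 * Sig <= S + 1280 * l * gamma ^+ 3 / (p ^+ 2 * q) * (2 * s2)
    + (gamma ^+ 2 * v + 10240 * l * gamma ^+ 3 / (p * q) ^+ 2 * s2) * W ->
  2 ^+ 11 * B * S <= eps * W -> 512 * (gamma * v) <= eps ->
  512 ^+ 2 * (gamma ^+ 2 * L * s2) <= (p * q) ^+ 2 * eps -> Sig <= eps * W.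
Proof.
move=> g0 gE B0 p0 q0 q1 eps0 l0 lL s20 W1 h hS hv hL.
have W0 : 0 <= W by apply: le_trans W1.
pose z := gamma ^+ 2 * l * s2 / (p * q) ^+ 2.
have pq0 : 0 < (p * q) ^+ 2 by rewrite exprn_gt0// mulr_gt0.
have z0 : 0 <= z by rewrite divr_ge0 ?(ltW pq0)// !mulr_ge0// ?sqr_ge0// ltW.
have gV : gamma^-1 = 512 * B by rewrite gE invrK.
have zle : 512 ^+ 2 * z <= eps.
  rewrite /z mulrA ler_pdivrMr//; apply: le_trans (_ : 512 ^+ 2 * (gamma ^+ 2 * L * s2) <= _).
    by rewrite ler_wpM2l ?sqr_ge0// ler_wpM2r// ler_wpM2l ?sqr_ge0.
  by rewrite mulrC in hL; rewrite mulrC [eps * _]mulrC.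
have zW : z * q <= z * W by rewrite ler_wpM2l// (le_trans q1).
have zeW : 512 ^+ 2 * (z * W) <= eps * W by rewrite mulrA ler_wpM2r.
have veW : 512 * (gamma * v * W) <= eps * W by rewrite mulrA ler_wpM2r.
have h2 : Sig <= 2 * gamma^-1 * S + 1280 * 4 * (z * q) + 2 * (gamma * v * W)
    + 10240 * 2 * (z * W).
  rewrite -(ler_pM2l (_ : 0 < gamma / 2)); last by rewrite divr_gt0.
  apply: le_trans h _; rewrite le_eqVlt; apply/orP; left; apply/eqP.
  by rewrite /z; field; rewrite !gt_eqF.
rewrite gV in h2.
have eW : 0 <= eps * W by rewrite mulr_ge0// ltW.
clear - h2 hS zW zeW veW eW; lra.
Qed.

(** The variables stand for the summands of [Phi] in order; keeping them abstract lets linear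
    arithmetic treat them as atoms. *)
Lemma sum_component_le {R : realFieldType}
    (a1 a2 a3 a4 a5 a6 a7 a8 a9 a10 a11 a12 a13 a14 a15 D : R) :
  0 <= a1 -> 0 <= a2 -> 0 <= a3 -> 0 <= a4 -> 0 <= a5 -> 0 <= a6 -> 0 <= a7 ->
  0 <= a8 -> 0 <= a9 -> 0 <= a10 -> 0 <= a11 -> 0 <= a12 -> 0 <= a13 -> 0 <= a14 ->
  0 <= a15 ->
  D = 2 + (a1 + a2 + a3 + a4 + a5 + a6 + a7 + a8 + a9 + a10 + a11 + a12
                + a13 + a14 + a15) ->
  [/\ 2 <= D, a4 <= D, a6 <= D & a8 <= D] /\ [/\ a9 <= D, a10 <= D, a12 <= D & a13 <= D].
Proof. by move=> *; do !split; lra. Qed.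

Theorem theorem9 :
  exists C k : nat,
  forall (R : realType) (n d : nat)
    (dO dZ dX1 dX2 : measure_display)
    (Omega : measurableType dO) (Z : measurableType dZ)
    (X1 : measurableType dX1) (X2 : measurableType dX2)
    (P : probability Omega R) (PZ : 'I_n -> probability Z R)
    (PX1 : probability X1 R) (PX2 : probability X2 R)
    (fi : 'I_n -> 'rV[R]_d -> R) (gfi : 'I_n -> 'rV[R]_d -> 'rV[R]_d)
    (Li : 'I_n -> R) (L mu sigma delta1 delta2 eps : R)
    (xs x0 : 'rV[R]_d)
    (g : 'I_n -> Z -> 'rV[R]_d -> 'rV[R]_d)
    (C1 : X1 -> 'rV[R]_d -> 'rV[R]_d) (C2 : X2 -> 'rV[R]_d -> 'rV[R]_d)
    (zeta : nat -> 'I_n -> Omega -> Z)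
    (xi1 : nat -> 'I_n -> Omega -> X1) (xi2 : nat -> 'I_n -> Omega -> X2),
  (0 < n)%N -> (0 < d)%N ->
  (* each f_i is L_i-smooth, with gradient gfi i *)
  (forall i, is_gradient (fi i) (gfi i)) ->
  (forall i, lipschitz_grad (gfi i) (Li i)) ->
  (* f = (1/n) sum f_i (whose gradient is (1/n) sum gfi) is L-smooth *)
  lipschitz_grad (fun x => avgv (fun i => gfi i x)) L ->
  (* xs is a minimizer of f *)
  (forall x, avgf fi xs <= avgf fi x) ->
  (* f is mu-strongly quasi-convex around xs *)
  0 < mu ->
  strongly_quasi_convex (avgf fi) (fun x => avgv (fun i => gfi i x)) mu xs ->
  (* the two contractive compressors *)
  0 < delta1 <= 1 -> 0 < delta2 <= 1 ->
  contractive PX1 C1 delta1 -> contractive PX2 C2 delta2 ->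
  seeded_measurable C1 -> seeded_measurable C2 ->
  (* stochastic gradient oracles *)
  0 <= sigma ->
  (forall i, stoch_oracle (PZ i) (g i) (gfi i) sigma) ->
  (forall i, seeded_measurable (g i)) ->
  (* fresh independent randomness at every call *)
  fresh_seeds P PZ PX1 PX2 zeta xi1 xi2 ->
  0 < eps ->
  let f := avgf fi in
  let fs := f xs in
  let Lt := Num.sqrt (n%:R^-1 * \sum_(i < n) Li i ^+ 2) in
  let A := sigma ^+ 2 / (mu * n%:R * eps)
           + Num.sqrt L * sigma / (mu * delta1 * delta2 * Num.sqrt eps)
           + Lt / (mu * delta1 * delta2) in
  let Phi := n%:R + mu + mu^-1 + L + L^-1 + Lt + Lt^-1 + sigma
             + delta1^-1 + delta2^-1 + eps + eps^-1
             + sqnorm (x0 - xs) + (f x0 - fs)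
             + n%:R^-1 * \sum_(i < n) sqnorm (gfi i xs) in
  exists (gamma : R) (T : nat),
    [/\ 0 < gamma,
        gamma <= delta1 * delta2 / (64 * Num.sqrt 2 * Lt),
        T%:R <= C%:R * A * (ln (2 + Phi)) ^+ k &
        (\sum_(t < T.+1)
           (out_weight gamma mu T t)%:E *
           \int[P]_w (f (st_x (alg_traj gamma x0 g C1 C2 zeta xi1 xi2 t w)) - fs)%:E
         <= eps%:E)%E].
Proof.
(* [c] stays abstract so that the unary numeral is never computed. *)
have [c cE] : exists c, c = (20 * 1024)%N by eexists.
(* Since [gamma mu / 2 = 1 / (1024 A)], a horizon of [20 * 1024 * A * ln D] makes the last weight at
   least [D^20]; one logarithm suffices. *)
exists c, 1%N.
move=> R n d dO dZ dX1 dX2 Omega Z X1 X2 P PZ PX1 PX2 fi gfi Li L mu sigma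
  delta1 delta2 eps xs x0 g C1 C2 zeta xi1 xi2 n0 d0 Hg HLi HL Hmin mu0 sqc d1 d2
  cC1 cC2 mC1 mC2 sigma0 og mg fresh eps0 f fs Lt A Phi.
have fgf := is_gradient_avgf fi gfi Hg.
have Lgfi i x y := norm2_leE _ _ _ (HLi i x y).
have LtE : Lt ^+ 2 = mean_sqr_Li Li by rewrite sqr_sqrtr// mean_sqr_Li_ge0.
have lipL x y := norm2_leE _ _ _ (HL x y).
have lipLt x y : sqnorm (gradf gfi x - gradf gfi y) <= Lt ^+ 2 * sqnorm (x - y).
  by rewrite LtE; exact: gradf_lipschitz_mean.
have L_ge0 := lipschitz_const_ge0 _ _ d0 HL.
have Lt_ge0 : 0 <= Lt by exact: sqrtr_ge0.
have muL := quasi_convex_modulus_le _ _ _ _ _ d0 fgf lipL Hmin sqc mu0 L_ge0.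
have muLt := quasi_convex_modulus_le _ _ _ _ _ d0 fgf lipLt Hmin sqc mu0 Lt_ge0.
(* Positivity of both smoothness constants is inherited from [mu]. *)
have half_gt0 x : mu <= 2 * x -> 0 < x.
  by move=> h; have := lt_le_trans mu0 h; rewrite pmulr_rgt0.
have L0 := half_gt0 _ muL; have Lt0 := half_gt0 _ muLt.
pose l := Num.min L Lt.
have l0 : 0 < l by rewrite lt_min L0.
have lL : l <= L by rewrite ge_min lexx.
have lLt : l <= Lt by rewrite ge_min lexx orbT.
have mu_le_2l : mu <= 2 * l by rewrite /l minEle; case: ifP.
have lipl x y : sqnorm (gradf gfi x - gradf gfi y) <= l ^+ 2 * sqnorm (x - y).
  by rewrite /l minEle; case: ifP => _; [exact: lipL|exact: lipLt].
have gradf_le x := sqnorm_gradient_le f (gradf gfi) fgf l fs lipl Hmin x l0.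
have [/andP[d10 d11] /andP[d20 d21]] := (d1, d2).
have n1 : 1 <= n%:R :> R by rewrite ler1n.
pose D := 2 + Phi.
have gap0 : 0 <= f x0 - fs by rewrite subr_ge0 Hmin.
have grad0 : 0 <= n%:R^-1 * \sum_(i < n) sqnorm (gfi i xs).
  by rewrite mulr_ge0 ?invr_ge0 ?ler0n// sumr_ge0// => i _; exact: sqnorm_ge0.
have inv_ge0 (x : R) : 0 < x -> 0 <= x^-1 by move=> x_gt0; rewrite invr_ge0 ltW.
have [[D2 hL hLt hsigma] [hp hq heps hS]] := sum_component_le _ _ _ _ _ _ _ _ _ _ _ _ _ _ _ D
  (ler0n R n) (ltW mu0) (inv_ge0 _ mu0) (ltW L0) (inv_ge0 _ L0) (ltW Lt0) (inv_ge0 _ Lt0)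
  sigma0 (inv_ge0 _ d10) (inv_ge0 _ d20) (ltW eps0) (inv_ge0 _ eps0)
  (sqnorm_ge0 (x0 - xs)) gap0 grad0 erefl.
have A0 : 0 < A :=
  A_gt0 L Lt mu sigma delta1 delta2 eps n%:R A n1 mu0 d1 d2 eps0 sigma0 Lt0 erefl.
have B0 : 0 < mu * A by exact: mulr_gt0.
pose gamma := (512 * (mu * A))^-1.
have gamma0 : 0 < gamma :=
  gamma_gt0 L Lt mu sigma delta1 delta2 eps n%:R A n1 mu0 d1 d2 eps0 sigma0 Lt0 erefl.
have gLt : 512 * (gamma * Lt) <= delta1 * delta2 :=
  gamma_Lt L Lt mu sigma delta1 delta2 eps n%:R A n1 mu0 d1 d2 eps0 sigma0 Lt0 erefl.
have gsigma : 512 * (gamma * (sigma ^+ 2 / n%:R)) <= eps :=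
  gamma_sigma L Lt mu sigma delta1 delta2 eps n%:R A n1 mu0 d1 d2 eps0 sigma0 Lt0 erefl.
have gsigmaL : 512 ^+ 2 * (gamma ^+ 2 * L * sigma ^+ 2) <= (delta1 * delta2) ^+ 2 * eps :=
  gamma_sigmaL L Lt mu sigma delta1 delta2 eps n%:R A n1 mu0 d1 d2 eps0 sigma0 L0 Lt0 erefl.
have gL512 : 512 ^+ 2 * (gamma ^+ 2 * mean_sqr_Li Li) <= (delta1 * delta2) ^+ 2.
  rewrite -LtE -exprMn -exprMn; apply: lerXn2r => //; rewrite nnegrE.
    by apply: mulr_ge0; [exact: ler0n|apply: mulr_ge0 => //; exact: ltW].
  by apply: mulr_ge0; exact: ltW.
have gl512 : 512 * (gamma * l) <= delta1 * delta2.
  apply: le_trans gLt; apply: ler_wpM2l; first exact: ler0n.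
  by apply: ler_wpM2l => //; exact: ltW.
have pq1 : delta1 * delta2 <= 1 by rewrite mulr_ile1// ltW.
have gl0 : 0 < gamma * l by exact: mulr_gt0.
have gl1 : 512 * (gamma * l) <= 1 by exact: le_trans pq1.
have gl16 : 16 * (gamma * l) <= 1.
  by apply: le_trans gl1; apply: ler_wpM2r; [exact: ltW|rewrite ler_nat].
pose rho := 1 - gamma * mu / 2.
have rho0 : 0 < rho.
  have h : gamma * mu <= gamma * (2 * l) by rewrite ler_pM2l.
  by clear - h gl1 gl0; rewrite /rho; lra.
pose W (T : nat) := \sum_(t < T.+1) rho ^- t.+1.
(* Rounding down keeps [T] within the claimed bound, while [T.+1], the exponent of the last weight,
   exceeds [c A ln D]. *)
pose T := Num.truncn (c%:R * A * ln D).
have D1 : 1 <= D by apply: le_trans D2; rewrite ler1n.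
have D0 : 0 < D by exact: lt_le_trans D1.
have lnD0 : 0 <= ln D by exact: ln_ge0.
have x0T : 0 <= c%:R * A * ln D.
  by apply: mulr_ge0 => //; apply: mulr_ge0; [exact: ler0n|exact: ltW].
have gmu2 : gamma * mu / 2 = (1024 * A)^-1.
  rewrite /gamma; have -> : 1024 = 512 * 2 :> R by rewrite -natrM.
  by field; rewrite !gt_eqF.
have WT : D ^+ 20 <= rho ^- T.+1.
  apply: le_trans (inv_pow_ge_expR (gamma * mu / 2) T.+1 rho0).
  rewrite -[D in leLHS](@lnK _ D) ?posrE// -expRM_natl ler_expR gmu2.
  rewrite [leRHS]mulrC ler_pdivlMr; last by apply: mulr_gt0; rewrite ?ltr0n.
  apply: le_trans (ltW (truncnS_gt _)); rewrite cE natrM.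
  by rewrite le_eqVlt; apply/orP; left; apply/eqP; ring.
have WTW : rho ^- T.+1 <= W T.
  rewrite /W big_ord_recr /= lerDr sumr_ge0// => t _.
  by rewrite invr_ge0 exprn_ge0// ltW.
have hW := le_trans WT WTW.
have W1 : 1 <= W T by apply: le_trans hW; exact: exprn_ege1.
have W0 : 0 < W T by exact: lt_le_trans W1.
exists gamma, T; split => //.
- exact: (gamma_cap L Lt mu sigma delta1 delta2 eps n%:R A n1 mu0 d1 d2 eps0 sigma0 Lt0 erefl).
- by rewrite expr1 truncn_le.
have gap t := integrable_gap P PZ PX1 PX2 gfi Li sigma delta1 delta2 gamma x0 g C1 C2
  zeta xi1 xi2 n0 Lgfi d1 d2 cC1 cC2 mC1 mC2 og mg fresh f xs mu l
  (gradient_continuous f (gradf gfi) fgf) Hmin gradf_le sqc mu0 l0 mu_le_2l gamma0 gl16 t.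
have bound := weighted_gap_bound P PZ PX1 PX2 gfi Li sigma delta1 delta2 gamma x0 g C1 C2
  zeta xi1 xi2 n0 Lgfi d1 d2 cC1 cC2 mC1 mC2 og mg fresh f xs mu l
  (gradient_continuous f (gradf gfi) fgf) Hmin gradf_le sqc mu0 l0 mu_le_2l gamma0 gl16
  gl512 gL512 T rho0.
pose F := Ft P gamma x0 g C1 C2 zeta xi1 xi2 f xs.
(* Integrability of the gap turns the extended-real expectations of the goal into real numbers. *)
have FE t : (\int[P]_w (f (st_x (alg_traj gamma x0 g C1 C2 zeta xi1 xi2 t w)) - fs)%:E
    = (F t)%:E)%E.
  exact: EFin_Rintegral (gap t).
under eq_bigr do rewrite FE -EFinM.
rewrite sumEFin lee_fin.
have -> : \sum_(t < T.+1) out_weight gamma mu T t * F t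
    = (\sum_(t < T.+1) rho ^- t.+1 * F t) / W T.
  by rewrite mulr_suml; apply: eq_bigr => t _; rewrite /out_weight mulrAC.
rewrite ler_pdivrMr//.
apply: (weighted_gap_le_eps gamma (mu * A) l L delta1 delta2 eps (sigma ^+ 2 / n%:R)
  (sigma ^+ 2) (sqnorm (x0 - xs)) (W T)) => //.
- exact: sqr_ge0.
- exact: (init_term_le L Lt mu sigma delta1 delta2 eps n%:R (sqnorm (x0 - xs)) D A n1 mu0
    d1 d2 eps0 sigma0 Lt0 (sqnorm_ge0 _) D2 hsigma hL hLt hp hq heps hS erefl (W T) hW).
Qed.
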